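(* Let $H$ be a monoid. The following are equivalent: (1) $H$ is a $t$-almost Dedekind $t$-SP-monoid (i.e. both $t$-almost Dedekind and a $t$-SP-monoid). (2) $H$ is a $w$-SP-monoid. (3) $H$ is a $w$-finite conductor monoid and every principal ideal of $H$ is a finite $w$-product of radical $w$-ideals of $H$. (4) Every $w$-ideal of $H$ is a $w$-product of finitely many pairwise comparable radical $w$-ideals of $H$. (5) The radical of every nontrivial principal ideal of $H$ is $w$-invertible.
   Context: A monoid $H$ is a commutative semigroup with identity and more than one element in which every nonzero element is cancellative. Here $z(H)=\{z\in H: zx=z \text{ for all } x\in H\}$ ($|z(H)|\le 1$, possibly empty); ''nonzero'' means not in $z(H)$; $H^{\bullet}=H\setminus z(H)$; $G=(H^{\bullet})^{-1}H$ is the quotient monoid; $\mathbb{N}$ is the set of positive integers. For $X\subseteq H$, $\sqrt X=\{x\in H: x^n\in X\text{ for some }n\in\mathbb{N}\}$; for $Y\subseteq G$, $Y^{-1}=\{z\in G: zY\subseteq H\}$. $X\subseteq H$ is an $s$-ideal if $X=XH\cup z(H)$; it is radical if $\sqrt X=X$; nontrivial if $z(H)\subsetneq X$; proper if $X\ne H$. A principal ideal is a set $AH\cup z(H)$ with $A\subseteq H$, $|A|\le 1$. A prime $s$-ideal is a proper $s$-ideal $P$ such that $xy\in P$ implies $x\in P$ or $y\in P$; $H_P=(H\setminus P)^{-1}H$. The $t$-system on $H$: if $H=G$, then for $X\subseteq H$ put $X_t=z(H)$ if $X\subseteq z(H)$ and $X_t=H$ otherwise; if $H\neq G$, put $X_v=(X^{-1})^{-1}$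 and $X_t=\bigcup_{E\subseteq X,|E|<\infty}E_v$. The $w$-system is $X_w=\{x\in H: xF\subseteq XH\cup z(H)\text{ and }F_t=H\text{ for some }F\subseteq H\}$. Both are finitary ideal systems. For $r\in\{t,w\}$: an $r$-ideal is an $X\subseteq H$ with $X_r=X$; it is $r$-invertible if $(XX^{-1})_r=H$; an $r$-ideal $I$ is $r$-finitely generated if $I=E_r$ for some finite $E\subseteq I$. The $r$-product of $r$-ideals $I,J$ is $(IJ)_r$ (similarly for finitely many factors). $r$-$\max(H)$ is the set of maximal elements among the proper $r$-ideals. $H$ is an $r$-SP-monoid if every $r$-ideal is a finite $r$-product of radical $r$-ideals. $H$ is an $r$-finite conductor monoid if $xH\cap yH$ is $r$-finitely generated for all $x,y\in H$. If $H\neq G$, $H$ is a DVM (discrete valuation monoid) if every $s$-ideal of $H$ is principal. $H$ is $t$-almost Dedekind if $H=G$ or $H_M$ is a DVM for each $M\in t$-$\max(H)$. ''Comparable'' means comparable with respect to inclusion. *)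

(* Defs.v *)
From HB Require Import structures.
From mathcomp Require Import all_boot generic_quotient.
From mathcomp Require Import boolp classical_sets cardinality.

Set Implicit Arguments.
Unset Strict Implicit.
Unset Printing Implicit Defensive.

Local Open Scope quotient_scope.
Local Open Scope group_scope.
Local Open Scope classical_set_scope.

(* A zero element need not exist; when there is none, every element is
   cancellative. *)
Definition is_zero (H : monoidType) (z : H) : Prop := forall x : H, z * x = z.

HB.mixin Record isCancelComMonoid H of Monoid H := {
  cmulgC : commutative (@mul H);
  cmulg_nontrivial : exists x : H, x <> 1;
  cmulgI : forall x : H, ~ is_zero x -> injective (mul x)
}.

#[short(type="cancelComMonoidType")]
HB.structure Definition CancelComMonoid := {H of isCancelComMonoid H & Monoid H}.

Section QuotientMonoid.
Variable H : cancelComMonoidType.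
Implicit Types a b c d h : H.

Lemma cmulg_inj a b c : ~ is_zero a -> a * b = a * c -> b = c.
Proof. by move=> a0; exact: (cmulgI _ a0). Qed.

Lemma cmulgAC a b c : a * b * c = a * c * b.
Proof. by rewrite -!mulgA (cmulgC b). Qed.

Lemma cmulgACA a b c d : (a * b) * (c * d) = (a * c) * (b * d).
Proof. by rewrite -!mulgA [b * (c * d)]mulgA (cmulgC b c) !mulgA. Qed.

Lemma is_zero1 : ~ is_zero (1 : H).
Proof. by move=> z1; have [x] := @cmulg_nontrivial H; rewrite -(mul1g x) z1. Qed.

Lemma is_zeroM a b : ~ is_zero a -> ~ is_zero b -> ~ is_zero (a * b).
Proof.
move=> a0 b0 ab0; apply: b0 => x; apply: (cmulg_inj a0).
by rewrite mulgA ab0.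
Qed.

(* The fraction (h, a) stands for a^-1 h. *)
Definition fraction := {p : H * H | `[< ~ is_zero p.2 >]}.

Implicit Types p q r : fraction.

Lemma fracP p : ~ is_zero (val p).2. Proof. by apply/asboolP/(valP p). Qed.

Arguments fracP : clear implicits.

Definition mkfrac h a (a0 : ~ is_zero a) : fraction :=
  exist _ (h, a) (asboolT a0).

Definition eqfrac (p q : fraction) := (val p).1 * (val q).2 == (val q).1 * (val p).2.

Lemma eqfrac_refl : reflexive eqfrac. Proof. by move=> p; rewrite /eqfrac. Qed.

Lemma eqfrac_sym : symmetric eqfrac.
Proof. by move=> p q; rewrite /eqfrac eq_sym. Qed.

Lemma eqfrac_trans : transitive eqfrac.
Proof.
move=> q p r; rewrite /eqfrac => /eqP pq /eqP qr; apply/eqP.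
apply: (cmulg_inj (fracP q)); rewrite ![(val q).2 * _]cmulgC cmulgAC pq.
by rewrite cmulgAC qr cmulgAC.
Qed.

Canonical eqfrac_equiv := EquivRel eqfrac eqfrac_refl eqfrac_sym eqfrac_trans.

Definition quotient_monoid := {eq_quot eqfrac}.

HB.instance Definition _ := Choice.on quotient_monoid.

Definition qfrac p : quotient_monoid := \pi_{eq_quot eqfrac} p.

Lemma eqfracP p q :
  qfrac p = qfrac q <-> (val p).1 * (val q).2 = (val q).1 * (val p).2.
Proof.
by split=> [/eqquotP/eqP//|pq]; apply/eqquotP/eqP.
Qed.

Lemma qfracK (x : quotient_monoid) : qfrac (repr x) = x. Proof. exact: reprK. Qed.

Definition mulfrac p q : fraction :=
  mkfrac ((val p).1 * (val q).1) (is_zeroM (fracP p) (fracP q)).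

Definition mulq (x y : quotient_monoid) : quotient_monoid :=
  qfrac (mulfrac (repr x) (repr y)).

Lemma mulq_frac p q : mulq (qfrac p) (qfrac q) = qfrac (mulfrac p q).
Proof.
apply/eqfracP => /=.
have /eqfracP ep := qfracK (qfrac p); have /eqfracP eq := qfracK (qfrac q).
by rewrite cmulgACA ep eq cmulgACA.
Qed.

Definition to_quot h : quotient_monoid := qfrac (mkfrac h is_zero1).

Lemma qfracW (P : quotient_monoid -> Prop) :
  (forall p, P (qfrac p)) -> forall x, P x.
Proof. by move=> Pq x; rewrite -(qfracK x). Qed.

Lemma mulqA : associative mulq.
Proof.
elim/qfracW=> p; elim/qfracW=> q; elim/qfracW=> r; rewrite !mulq_frac.
by apply/eqfracP; rewrite /= !mulgA.
Qed.

Lemma mulqC : commutative mulq.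
Proof.
elim/qfracW=> p; elim/qfracW=> q; rewrite !mulq_frac.
by apply/eqfracP; rewrite /= (cmulgC (val p).1) (cmulgC (val p).2).
Qed.

Lemma mul1q : left_id (to_quot 1) mulq.
Proof.
by elim/qfracW=> p; rewrite mulq_frac; apply/eqfracP; rewrite /= !mul1g.
Qed.

Lemma mulq1 : right_id (to_quot 1) mulq.
Proof. by move=> p; rewrite mulqC mul1q. Qed.

HB.instance Definition _ := hasMul.Build quotient_monoid mulq.
HB.instance Definition _ := Magma_isSemigroup.Build quotient_monoid mulqA.
HB.instance Definition _ := hasOne.Build quotient_monoid (to_quot 1).
HB.instance Definition _ :=
  BaseUMagma_isUMagma.Build quotient_monoid mul1q mulq1.

Lemma to_quotM : {morph to_quot : a b / a * b}.
Proof.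
by move=> a b; rewrite [RHS]mulq_frac; apply/eqfracP; rewrite /= !mulg1.
Qed.

Lemma to_quot_inj : injective to_quot.
Proof. by move=> x y /eqfracP /=; rewrite !mulg1. Qed.

Lemma to_quot_unit a : ~ is_zero a -> exists g, to_quot a * g = 1.
Proof.
move=> a0; exists (qfrac (mkfrac 1 a0)).
by rewrite [LHS]mulq_frac; apply/eqfracP; rewrite /= !mulg1 !mul1g.
Qed.

Lemma quotient_frac (g : quotient_monoid) :
  exists a h, ~ is_zero a /\ to_quot a * g = to_quot h.
Proof.
elim/qfracW: g => p; exists (val p).2, (val p).1; split; first exact: fracP.
by rewrite [LHS]mulq_frac; apply/eqfracP; rewrite /= !mul1g mulg1 cmulgC.
Qed.

Lemma quotient_nontrivial : exists x : quotient_monoid, x <> 1.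
Proof.
by have [x x1] := @cmulg_nontrivial H; exists (to_quot x) => /to_quot_inj.
Qed.

Lemma quotient_mulI (x : quotient_monoid) : ~ is_zero x -> injective (mul x).
Proof.
elim/qfracW: x => p p0.
have n0 : ~ is_zero (val p).1.
  move=> z; apply: p0; elim/qfracW=> q.
  by rewrite [LHS]mulq_frac; apply/eqfracP; rewrite /= -mulgA !z.
have pV : qfrac (mkfrac (val p).2 n0) * qfrac p = 1.
  by rewrite [LHS]mulq_frac; apply/eqfracP; rewrite /= mulg1 mul1g cmulgC.
move=> y z /(congr1 (mul (qfrac (mkfrac (val p).2 n0)))).
by rewrite !mulgA pV !mul1g.
Qed.

HB.instance Definition _ := isCancelComMonoid.Build quotient_monoid
  mulqC quotient_nontrivial quotient_mulI.

(* From here on H is identified with this submonoid of its quotient monoid, so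
   that H, G and all localizations H_P are subsets of one monoid. *)
Definition in_quotient : set quotient_monoid := range to_quot.

End QuotientMonoid.

Arguments to_quot {H} h.
Arguments in_quotient H _ : clear implicits.

Section IdealSystems.
(* H is a submonoid of the ambient monoid G. *)
Variables (G : monoidType) (H : set G).
Implicit Types (X Y P : set G).

Definition prodset X Y : set G := [set x * y | x in X & y in Y].

Definition zeros : set G := [set z | H z /\ forall x, H x -> z * x = z].

(* (H \ P)^-1 H inside G, for G a monoid in which the nonzero elements of H are
   invertible: s^-1 h is the solution g of s g = h. *)
Definition localization P : set G :=
  [set g | exists2 s, (H `\` P) s & H (s * g)].

Definition quotient : set G := localization zeros.

Definition radical X : set G :=
  [set x | H x /\ exists2 n, (0 < n)%N & X (x ^+ n)].

Definition gen_ideal X : set G := prodset X H `|` zeros.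

Definition s_ideal X := X `<=` H /\ X = gen_ideal X.

Definition principal X :=
  exists A, [/\ A `<=` H, is_subset1 A & X = gen_ideal A].

Definition nontrivial X := zeros `<` X.

Definition inverse Y : set G :=
  [set g | quotient g /\ forall y, Y y -> H (g * y)].

Definition v_system X : set G := inverse (inverse X).

Definition t_system X : set G :=
  if `[< H = quotient >] then
    if `[< X `<=` zeros >] then zeros else H
  else \bigcup_(E in [set E | E `<=` X /\ finite_set E]) v_system E.

Definition w_system X : set G :=
  [set x | H x /\ exists F, [/\ F `<=` H,
     prodset [set x] F `<=` gen_ideal X & t_system F = H]].

Definition DVM := H <> quotient /\ forall X, s_ideal X -> principal X.

Section System.
(* r is meant to be t_system or w_system. *)
Variable r : set G -> set G.

Definition r_ideal X := X `<=` H /\ r X = X.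

Definition radical_r_ideal X := r_ideal X /\ radical X = X.

Definition r_product n (I : 'I_n -> set G) : set G :=
  r (\big[prodset/[set 1]]_(i < n) I i).

Definition r_invertible X := r_ideal X /\ r (prodset X (inverse X)) = H.

Definition r_fin_gen X :=
  r_ideal X /\ exists E, [/\ E `<=` X, finite_set E & X = r E].

Definition r_max : set (set G) :=
  [set M | [/\ r_ideal M, M <> H &
     forall N, r_ideal N -> N <> H -> M `<=` N -> N = M]].

(* Only nonempty products are considered; the empty one would be H itself, which
   is already a radical r-ideal. *)
Definition radical_r_product X :=
  exists n (I : 'I_n.+1 -> set G),
    (forall i, radical_r_ideal (I i)) /\ X = r_product I.

Definition comparable_radical_r_product X :=
  exists n (I : 'I_n.+1 -> set G),
    [/\ forall i, radical_r_ideal (I i),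
        forall i j, I i `<=` I j \/ I j `<=` I i & X = r_product I].

Definition SP_monoid := forall X, r_ideal X -> radical_r_product X.

Definition finite_conductor_monoid :=
  forall x y, H x -> H y ->
    r_fin_gen (prodset [set x] H `&` prodset [set y] H).

End System.

End IdealSystems.

(* The t-maximal ideals M are prime s-ideals whenever H is not its own quotient,
   so localization H M is a submonoid. *)
Definition t_almost_Dedekind (G : monoidType) (H : set G) :=
  H = quotient H \/
  forall M, r_max H (t_system H) M -> DVM (localization H M).

Lemma zeros_in_quotient (M : cancelComMonoidType) :
  zeros (in_quotient M) = to_quot @` [set z : M | is_zero z].
Proof.
apply/seteqP; split=> [_ [[z _ <-] zz]|_ [z zz <-]] /=.
  exists z => // x; apply: to_quot_inj.
  by rewrite to_quotM zz //; exists x.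
by split=> [|_ [x _ <-]]; [exists z | rewrite -to_quotM zz].
Qed.

Lemma quotient_in_quotient (M : cancelComMonoidType) :
  quotient (in_quotient M) = setT.
Proof.
apply/seteqP; split=> // g _; have [a [h [a0 ag]]] := quotient_frac g.
exists (to_quot a); last by rewrite ag; exists h.
split; first by exists a.
by rewrite zeros_in_quotient => -[z zz /to_quot_inj za]; apply: a0; rewrite -za.
Qed.

(* Main.v *)
Require Import Defs.
From HB Require Import structures.
From mathcomp Require Import all_boot.
From mathcomp Require Import boolp classical_sets cardinality.

(** Write [G] for the quotient monoid of [H]. If [H = G], the only ideals are
    [H] and its set of zeros, and everything is immediate. Otherwise all five
    conditions are read off the localizations [H_P] at the maximal t-ideals [P],
    which are prime. By Zorn's lemma a subset of [H] has t-closure [H] as soon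
    as it is contained in no [P] ([inverse_trivial_sub]), so [x] is in the
    w-closure of [X] if and only if it is locally in the ideal generated by [X]
    ([w_local]), and [I] is w-invertible if and only if every [P] misses a
    product [i g] with [i] in [I] and [g] in [I^-1] ([invertibleP]). In
    particular [I] is then locally principal, and w-finitely generated.

    The core of the proof is that two w-invertible radical ideals [I] and [J]
    are comparable at every [P]. Suppose that a finite subset [E] of the
    intersection [C] of [I] and [J] is such that [q E] is contained in [C] only
    for [q] in [H]. Multiplying [E] by finite generating sets of [I^-1] and
    [J^-1] then gives a finite set with inverse [H]. So one of the products,
    say [c e] with [e] in [I^-1], is outside [P], and [c e I] is contained in
    [J] ([invertible_comparable]). Such an [E] exists under (3), because finite
    conductors make [C] w-finitely generated, and because factorizations into
    radical ideals make [H] completely integrally closed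
    ([radical_factorial_almost_integral]); it also exists if [C] itself is
    w-invertible, as it is under (5) for radicals of principal ideals. Under
    (2), comparability follows from a factorization of the w-ideal generated by
    [a] and [b ^+ 2], where [a] and [b] generate [I] and [J] at [P]
    ([SP_locally_comparable]).

    Comparability makes intersections of w-invertible radical ideals
    w-invertible. If the principal ideals are products of radical ideals, their
    factors are w-invertible and the radical of [x H] is the intersection of
    the factors of [x H]; thus (2) and (3) imply (5).

    Conversely, assume (5). Then [H_P] has enough radical elements, they are
    totally ordered by divisibility, and so the nonunits among them are all
    associated to one element [pi P], whose powers are all the nonzero elements
    of [H_P] up to units ([uniformizer_exists]): [H_P] is a discrete valuation
    monoid with a valuation [v_P]. A nonzero w-ideal [X] is the w-product of the radical
    ideals [level X k], where [level X k] is the intersection of the [P] at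
    which the minimum of [v_P] on [X] is [> k]. There are finitely many factors
    because [v_P x] is bounded for a fixed nonzero [x] ([val_bounded]), and the
    local values are right because the sets of [P] in question can be separated
    from any other maximal t-ideal ([val_separation]). This gives (4), and hence
    (2). Finally, when divisibility is total in every [H_P], t and w coincide
    on subsets of [H] ([t_systemE]), which identifies (1) with (2), and the
    ideals [x H `&` y H] are w-invertible, which gives the finite conductor
    property. *)

Set Implicit Arguments.
Unset Strict Implicit.
Unset Printing Implicit Defensive.

Local Open Scope group_scope.
Local Open Scope classical_set_scope.

(** * Products in commutative monoids *)

HB.instance Definition _ (G : cancelComMonoidType) :=
  SemiGroup.isCommutativeLaw.Build G mul (@cmulgC G).

(** Syntax for products: two products with the same factors have the same
    value, which is decided on the lists of the indices of the factors. *)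
Inductive monomial := MOne | MVar of nat | MMul of monomial & monomial.

Fixpoint monomial_vars (e : monomial) : seq nat :=
  match e with
  | MOne => [::]
  | MVar i => [:: i]
  | MMul e1 e2 => monomial_vars e1 ++ monomial_vars e2
  end.

Fixpoint monomial_eval (G : cancelComMonoidType) (env : seq G) (e : monomial) : G :=
  match e with
  | MOne => 1
  | MVar i => nth 1 env i
  | MMul e1 e2 => monomial_eval env e1 * monomial_eval env e2
  end.

Lemma monomial_evalE (G : cancelComMonoidType) (env : seq G) e :
  monomial_eval env e = \big[mul/1]_(i <- monomial_vars e) nth 1 env i.
Proof.
elim: e => [|i|e1 IH1 e2 IH2] /=; first by rewrite big_nil.
  by rewrite big_seq1.
by rewrite big_cat /= IH1 IH2.
Qed.

Lemma monomial_eq (G : cancelComMonoidType) (env : seq G) e1 e2 :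
  perm_eq (monomial_vars e1) (monomial_vars e2) ->
  monomial_eval env e1 = monomial_eval env e2.
Proof. by move=> e12; rewrite !monomial_evalE (perm_big _ e12). Qed.

Ltac env_index env a :=
  lazymatch env with
  | a :: _ => constr:(0%N)
  | _ :: ?env' => let i := env_index env' a in constr:(S i)
  end.

Ltac env_add env t :=
  lazymatch t with
  | @mul _ ?a ?b => let env1 := env_add env a in env_add env1 b
  | @monoid.one _ => env
  | _ => match env with
         | _ => let i := env_index env t in env
         | _ => constr:(t :: env)
         end
  end.

Ltac monomial_of env t :=
  lazymatch t with
  | @mul _ ?a ?b =>
      let e1 := monomial_of env a in
      let e2 := monomial_of env b in constr:(MMul e1 e2)
  | @monoid.one _ => constr:(MOne)
  | _ => let i := env_index env t in constr:(MVar i)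
  end.

(* Proves an equality of two products with the same factors. *)
Ltac mulgAC_eq :=
  lazymatch goal with
  | |- @eq ?T ?a ?b =>
      let env0 := env_add (@nil T) a in
      let env := env_add env0 b in
      let e1 := monomial_of env a in
      let e2 := monomial_of env b in
      exact (@monomial_eq _ env e1 e2 isT)
  end.

(* Multiplies the equation E by c and compares with the goal up to the order of
   the factors. *)
Tactic Notation "mulgAC_from" constr(c) constr(E) :=
  lazymatch type of E with
  | ?l = ?r =>
      transitivity (c * l);
      [mulgAC_eq | transitivity (c * r); [exact (congr1 (mul c) E) | mulgAC_eq]]
  end.

(** * The quotient monoid and its submonoids *)

Section Overmonoids.
Variable M : cancelComMonoidType.
Local Notation G := (quotient_monoid M).
Local Notation H := (in_quotient M).
Implicit Types (a b c g h s x y z : G) (N : set G).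

Lemma zeroM a b : is_zero a -> is_zero (a * b).
Proof. by move=> za; rewrite za. Qed.

Lemma zeroMr a b : is_zero b -> is_zero (a * b).
Proof. by rewrite cmulgC; exact: zeroM. Qed.

Lemma nonzeroMl a b : ~ is_zero (a * b) -> ~ is_zero a.
Proof. by move=> n /(@zeroM _ b). Qed.

Lemma nonzeroMr a b : ~ is_zero (a * b) -> ~ is_zero b.
Proof. by move=> n /(@zeroMr a). Qed.

Lemma nonzeroX a n : ~ is_zero a -> ~ is_zero (a ^+ n).
Proof.
move=> na; elim: n => [|n IHn]; first exact: is_zero1.
by rewrite expgS; exact: is_zeroM.
Qed.

Lemma expgMnC a b n : (a * b) ^+ n = a ^+ n * b ^+ n.
Proof. by apply: expgMn; exact: cmulgC. Qed.

Lemma expgSC a n : a ^+ n.+1 = a * a ^+ n.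
Proof. exact: expgS. Qed.

Lemma expgDC a m n : a ^+ (m + n) = a ^+ m * a ^+ n.
Proof. exact: expgnDr. Qed.

Lemma to_quot_zero (h : M) : is_zero (to_quot h) <-> is_zero h.
Proof.
split=> [zh x|zh g]; first by apply: to_quot_inj; rewrite to_quotM zh.
have [a [b [a0 ab]]] := quotient_frac g.
by rewrite -{1}(zh a) to_quotM -mulgA ab -to_quotM zh.
Qed.

Lemma zero_in_quotient z : is_zero z -> H z.
Proof.
move=> zz; have [a [h [_ az]]] := quotient_frac z.
by exists h => //; rewrite -az cmulgC zz.
Qed.

Lemma quotient_inv x : ~ is_zero x -> exists y, x * y = 1.
Proof.
move=> x0; have [a [h [a0 ax]]] := quotient_frac x.
have h0 : ~ is_zero h.
  by move=> /to_quot_zero; rewrite -ax; apply: is_zeroM => // /to_quot_zero.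
have [y hy] := to_quot_unit h0.
by exists (to_quot a * y); rewrite mulgA [x * _]cmulgC ax.
Qed.

Lemma frac_in_quotient g : exists s, [/\ H s, ~ is_zero s & H (s * g)].
Proof.
have [a [h [a0 ag]]] := quotient_frac g; exists (to_quot a).
by split; [exists a | move/to_quot_zero | rewrite ag; exists h].
Qed.

Definition overmonoid N := H `<=` N /\ forall x y, N x -> N y -> N (x * y).

Lemma overmonoidH : overmonoid H.
Proof.
by split=> // _ _ [x _ <-] [y _ <-]; exists (x * y) => //; rewrite to_quotM.
Qed.

Lemma in_quotientM x y : H x -> H y -> H (x * y).
Proof. exact: overmonoidH.2. Qed.

Lemma in_quotient1 : H 1. Proof. by exists 1. Qed.

Lemma in_quotientX x n : H x -> H (x ^+ n).
Proof.
move=> Hx; elim: n => [|n IHn]; first exact: in_quotient1.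
by rewrite expgS; exact: in_quotientM.
Qed.

Lemma zerosE N : overmonoid N -> zeros N = [set z | is_zero z].
Proof.
move=> [HN _]; apply/seteqP; split=> [z [_ zz] g|z zz].
  have [s [Hs _ Hsg]] := frac_in_quotient g.
  by rewrite -{1}(zz s (HN _ Hs)) -mulgA zz //; exact: HN.
by split=> [|x _]; [exact/HN/zero_in_quotient | exact: zz].
Qed.

Lemma quotientE N : overmonoid N -> quotient N = setT.
Proof.
move=> N_; rewrite /quotient (zerosE N_); apply/seteqP; split=> // g _.
have [s [Hs s0 Hsg]] := frac_in_quotient g.
by exists s; [split=> //; exact: N_.1 | exact: N_.1].
Qed.

Lemma gen_idealP N X y : overmonoid N ->
  gen_ideal N X y <-> (exists a n, [/\ X a, N n & y = a * n]) \/ is_zero y.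
Proof.
move=> N_; rewrite /gen_ideal (zerosE N_); split=> -[].
- by move=> [a Xa [n Nn <-]]; left; exists a, n.
- by right.
- by move=> [a [n [Xa Nn ->]]]; left; exists a => //; exists n.
- by right.
Qed.

(** Divisibility in [N], for elements of [G]; for [N := H_P] this compares the
    localizations at [P] of principal ideals. *)
Definition divides N a b := exists2 n, N n & b = a * n.

Section Divisibility.
Variable N : set G.
Hypothesis N_ : overmonoid N.

Let N1 : N 1. Proof. by apply: N_.1; exact: in_quotient1. Qed.

Lemma dvd_refl a : divides N a a.
Proof. by exists 1 => //; rewrite mulg1. Qed.

Lemma dvd_trans b a c : divides N a b -> divides N b c -> divides N a c.
Proof.
move=> [m Nm ->] [n Nn ->]; exists (m * n); first exact: N_.2.
by rewrite mulgA.
Qed.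

Lemma dvd_mul a b c d :
  divides N a b -> divides N c d -> divides N (a * c) (b * d).
Proof.
move=> [m Nm ->] [n Nn ->]; exists (m * n); first exact: N_.2.
by mulgAC_eq.
Qed.

End Divisibility.
End Overmonoids.

(** * Maximal t-ideals *)

Section MaximalIdeals.
Variable M : cancelComMonoidType.
Local Notation G := (quotient_monoid M).
Local Notation H := (in_quotient M).
Local Notation t := (t_system H).
Local Notation w := (w_system H).
Hypothesis HG : H <> setT.
Implicit Types (a b c g h s x y z q : G) (E F I J X Y P Q : set G).

Lemma inverseP Y g : inverse H Y g <-> forall y, Y y -> H (g * y).
Proof.
rewrite /inverse (quotientE (@overmonoidH M)).
by split=> [[]//|gY]; split.
Qed.

Lemma v_systemP E x :
  v_system H E x <-> forall q, (forall e, E e -> H (q * e)) -> H (x * q).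
Proof.
rewrite /v_system; split=> [/inverseP xE q /inverseP|xE]; first exact: xE.
by apply/inverseP => q /inverseP; exact: xE.
Qed.

Lemma t_systemP X x : t X x <->
  exists E, [/\ E `<=` X, finite_set E & v_system H E x].
Proof.
rewrite /t_system (quotientE (@overmonoidH M)); case: asboolP => // _.
by split=> [[E [EX fE] vE]|[E [EX fE vE]]]; exists E.
Qed.

(** The finite subsets of [H] whose inverse is [H] are those whose t-closure is
    [H], and every set with t-closure [H] contains one of them. *)
Definition inverse_trivial F :=
  [/\ F `<=` H, finite_set F & forall q, (forall f, F f -> H (q * f)) -> H q].

Lemma t_systemH X : X `<=` H ->
  t X = H <-> exists2 F, F `<=` X & inverse_trivial F.
Proof.
move=> XH; split=> [tX|[F FX [FH fF Fq]]].
  have /t_systemP[E [EX fE /v_systemP vE]] : t X 1.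
    by rewrite tX; exact: in_quotient1.
  exists E => //; split=> // [e /EX /XH//|q qE].
  by rewrite -[q]mul1g; exact: vE.
apply/seteqP; split=> x.
  move=> /t_systemP[E [EX fE /v_systemP vE]]; rewrite -[x]mulg1; apply: vE.
  by move=> e /EX /XH; rewrite mul1g.
move=> Hx; apply/t_systemP; exists F; split=> //; apply/v_systemP => q /Fq Hq.
exact: in_quotientM.
Qed.

(** Finitely many elements suffice in the definition of w. *)
Lemma w_systemP X x : w X x <->
  H x /\ exists2 F, inverse_trivial F & forall f, F f -> gen_ideal H X (x * f).
Proof.
split=> [[Hx [F [FH xF /(t_systemH FH)[F' F'F F'triv]]]]|[Hx [F Ftriv xF]]].
  by split=> //; exists F' => // f /F'F Ff; apply: xF; exists x => //; exists f.
split=> //; exists F; split; first by case: Ftriv.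
  by move=> _ [_ -> [f Ff <-]]; exact: xF.
by apply/t_systemH; [case: Ftriv | exists F].
Qed.

Definition tmax P := r_max H t P.

Section TMax.
Variable P : set G.
Hypothesis Pmax : tmax P.

Lemma tmax_sub : P `<=` H. Proof. by have [[]] := Pmax. Qed.

Lemma tmaxV E x : E `<=` P -> finite_set E -> v_system H E x -> P x.
Proof. have [[_ tP] _ _] := Pmax => EP fE vE.
by rewrite -tP; apply/t_systemP; exists E. Qed.

Lemma tmaxM x h : P x -> H h -> P (x * h).
Proof.
move=> Px Hh; apply: (@tmaxV [set x]) => //; first by move=> _ ->.
apply/v_systemP => q /(_ x erefl) Hqx.
have ->: x * h * q = h * (q * x) by mulgAC_eq.
exact: in_quotientM.
Qed.

Lemma tmax_inverse_trivial F : inverse_trivial F -> exists2 f, F f & ~ P f.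
Proof.
move=> [FH fF Fq]; apply: contrapT => nF; have [_ + _] := Pmax; apply.
apply/seteqP; split=> [|h Hh]; first exact: tmax_sub.
have FP : F `<=` P.
  by move=> f Ff; apply: contrapT => nPf; apply: nF; exists f.
apply: (tmaxV FP) => //; apply/v_systemP => q /Fq; exact: in_quotientM.
Qed.

Lemma tmax1 : ~ P 1.
Proof.
move=> P1; have [_ + _] := Pmax; apply; apply/seteqP; split=> [|h Hh].
  exact: tmax_sub.
by rewrite -[h]mul1g; exact: tmaxM.
Qed.

Lemma tmax_zero z : is_zero z -> P z.
Proof.
move=> zz; apply: (@tmaxV set0) => //; apply/v_systemP => q _.
by rewrite zz; exact: zero_in_quotient.
Qed.

Lemma tmax_nonzero x : ~ P x -> ~ is_zero x.
Proof. by move=> nPx /tmax_zero. Qed.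

(** If [x y] lies in [P] and [x] does not, the proper t-ideal of all [h] with
    [h x] in [P] contains [P], hence equals [P], and contains [y]. *)
Lemma tmax_prime x y : H x -> H y -> ~ P x -> ~ P y -> ~ P (x * y).
Proof.
move=> Hx Hy nPx nPy Pxy; apply: nPy.
pose J := [set h | H h /\ P (h * x)].
have JH : J `<=` H by move=> h [].
have Jid : r_ideal H t J.
  split=> //; apply/seteqP; split=> [h|h Jh]; last first.
    apply/t_systemP; exists [set h]; split=> // [_ ->//|].
    by apply/v_systemP => q /(_ h erefl); rewrite cmulgC.
  move=> /t_systemP[E [EJ fE /v_systemP vE]]; split.
    rewrite -[h]mulg1; apply: vE => e /EJ[He _].
    by rewrite mul1g.
  apply: (@tmaxV [set e * x | e in E]) => [_ [e /EJ[_ +] <-]//||].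
    exact: finite_image.
  apply/v_systemP => q qE; have ->: h * x * q = h * (q * x) by mulgAC_eq.
  apply: vE => e Ee; have ->: q * x * e = q * (e * x) by mulgAC_eq.
  by apply: qE; exists e.
have [_ _ Pm] := Pmax; rewrite -(Pm J Jid); first by rewrite /J/= cmulgC.
  move=> JE; apply: nPx; have [_] : J 1 by rewrite JE; exact: in_quotient1.
  by rewrite mul1g.
by move=> h Ph; split; [exact: tmax_sub | exact: tmaxM].
Qed.

End TMax.

(** Zorn's lemma applies to the sets without inverse-trivial subsets because
    inverse-trivial sets are finite; a maximal such set is closed under t. *)
Lemma tmax_exists X : X `<=` H ->
  ~ (exists2 F, F `<=` X & inverse_trivial F) ->
  exists2 P, tmax P & X `<=` P.
Proof.
move=> XH nX.
pose good Y := Y `<=` H /\ ~ exists2 F, F `<=` Y & inverse_trivial F.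
(* Taking unions with [X] makes the union of the empty chain good. *)
pose ext Y := good (X `|` Y).
have [F Fext|A [extA Amax]] := @Zorn_bigcup _ ext.
  move=> Ftot; rewrite /ext /good; split=> [x [/XH//|[Y FY Yx]]|].
    by apply: (Fext _ FY).1; right.
  move=> [E EF [EH fE Eq]].
  have [Y [XFY EY]] : exists Y, (Y = X \/ F Y) /\ E `<=` X `|` Y.
    move/finite_seqP: fE => [s sE]; rewrite {}sE in EF *; move: EF {EH Eq}.
    elim: s => [|e s IHs] EF; first by exists X; split; [left | move=> ?].
    have [x xs|Y [XFY sY]] := IHs; first by apply: EF; rewrite /= in_cons xs orbT.
    have [Z [XFZ Ze]] : exists Z, (Z = X \/ F Z) /\ (X `|` Z) e.
      have [Xe|[Z FZ Ze]] := EF e (mem_head e s).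
        by exists X; split; [left | left].
      by exists Z; split; [right | right].
    have [YZ|ZY] : X `|` Y `<=` X `|` Z \/ X `|` Z `<=` X `|` Y.
      case: XFY => [->|FY]; first by left=> x [] Xx; left.
      case: XFZ => [->|FZ]; first by right=> x [] Xx; left.
      by case: (Ftot _ _ FY FZ) => YZ; [left | right]; apply: setUS.
    - exists Z; split=> // x; rewrite /= in_cons => /orP[/eqP->//|xs].
      by apply: YZ; exact: sY.
    - exists Y; split=> // x; rewrite /= in_cons => /orP[/eqP->|xs].
        exact: ZY.
      exact: sY.
  have [XY|FY] := XFY.
    by apply: nX; exists E => // x /EY; rewrite XY setUid.
  by apply: (Fext _ FY).2; exists E.
pose P := X `|` A; have [PH nP] : good P := extA.
have Pmx Y : good Y -> P `<=` Y -> Y = P.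
  move=> gY PY; apply/seteqP; split=> // y Yy; apply: contrapT => nPy.
  apply: (Amax Y); last first.
    by rewrite /ext setUidr // => x Xx; apply: PY; left.
  split=> [a Aa|YA]; first by apply: PY; right.
  by apply: nPy; right; exact: YA.
have PH_sub E : E `<=` P -> E `<=` H by move=> EP e /EP /PH.
have tP_good : good (t P).
  split=> [x /t_systemP[E [EP _ /v_systemP vE]]|[F FtP [_ fF Ftriv]]].
    by rewrite -[x]mulg1; apply: vE => e /EP /PH; rewrite mul1g.
  have /choice[S SE] f : exists E, F f -> 
      [/\ E `<=` P, finite_set E & v_system H E f].
    have [Ff|nFf] := pselect (F f); last by exists set0.
    by have /t_systemP[E HE] := FtP f Ff; exists E.
  apply: nP; exists (\bigcup_(f in F) S f).
    by move=> x [f Ff]; have [SP _ _] := SE f Ff; exact: SP.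
  split; first by apply: PH_sub => x [f Ff]; have [SP _ _] := SE f Ff; exact: SP.
    by apply: bigcup_finite => // f Ff; have [] := SE f Ff.
  move=> q qS; apply: Ftriv => f Ff; rewrite cmulgC.
  have [_ _ /v_systemP] := SE f Ff; apply => e Se.
  by apply: qS; exists f.
have t_ext Y : Y `<=` H -> Y `<=` t Y.
  move=> YH y Yy; apply/t_systemP; exists [set y]; split=> // [_ ->//|].
  by apply/v_systemP => q /(_ y erefl); rewrite cmulgC.
exists P; last by left.
split; first by split=> //; apply: Pmx => //; exact: t_ext.
  move=> PHe; apply: nP; exists [set 1].
    by rewrite PHe => _ ->; exact: in_quotient1.
  split=> // [_ ->|q /(_ 1 erefl)]; first exact: in_quotient1.
  by rewrite mulg1.
move=> N [NH tN] nNH PN; apply: Pmx => //; split=> // /(t_systemH NH).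
by rewrite tN.
Qed.

(** Nonmembership in maximal t-ideals detects the inverse-trivial subsets; this
    is how every statement about t and w becomes a statement about
    localizations. *)
Lemma inverse_trivial_sub X : X `<=` H ->
  (forall P, tmax P -> exists2 x, X x & ~ P x) ->
  exists2 F, F `<=` X & inverse_trivial F.
Proof.
move=> XH XP; apply: contrapT => nX; have [P Pmax XsP] := tmax_exists XH nX.
by have [x /XsP] := XP P Pmax.
Qed.

(** The localization [I_P] of a set [I] at [P]. For [I := H] this is convertible
    to [localization H P]. *)
Definition local P I := [set g | exists2 s, (H `\` P) s & I (s * g)].

Lemma local_globalH g : (forall P, tmax P -> local P H g) -> H g.
Proof.
move=> locg.
have [x [Hx _]|P Pmax|F FX [_ _ Fq]] :=
    @inverse_trivial_sub [set s | H s /\ H (s * g)].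
- exact: Hx.
- by have [s [Hs nPs] Hsg] := locg P Pmax; exists s.
- by apply: Fq => f /FX[_]; rewrite cmulgC.
Qed.

(** If [x] is locally in [X H], then the [s] such that [s x] is in [X H] form a
    set contained in no [P], so that it has a subset [F] as in the definition of
    w. *)
Lemma w_local X x :
  w X x <-> H x /\ forall P, tmax P -> local P (gen_ideal H X) x.
Proof.
split=> [/w_systemP[Hx [F Ftriv xF]]|[Hx locx]].
  split=> // P Pmax; have [f Ff nPf] := tmax_inverse_trivial Pmax Ftriv.
  exists f; first by split=> //; case: Ftriv => + _ _; apply.
  by rewrite cmulgC; exact: xF.
apply/w_systemP; split=> //.
have [s [Hs _]//|P Pmax|F FX Ftriv] :=
    @inverse_trivial_sub [set s | H s /\ gen_ideal H X (s * x)].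
- by have [s [Hs nPs] Xsx] := locx P Pmax; exists s.
- by exists F => // f /FX[_]; rewrite cmulgC.
Qed.


(** * Localizations, w-ideals and w-invertibility *)

Section AtP.
Variable P : set G.
Hypothesis Pmax : tmax P.
Local Notation N := (local P H).

Lemma local_in I x : I x -> local P I x.
Proof.
move=> Ix; exists 1; last by rewrite mul1g.
by split; [exact: in_quotient1 | exact: tmax1 Pmax].
Qed.

Lemma localS I J : I `<=` J -> local P I `<=` local P J.
Proof. by move=> IJ x [s sP /IJ]; exists s. Qed.

Lemma local_denom I s x : H s -> ~ P s -> local P I (s * x) -> local P I x.
Proof.
move=> Hs nPs [u [Hu nPu] Iusx]; exists (u * s); last by rewrite -mulgA.
by split; [exact: in_quotientM | exact: tmax_prime].
Qed.

Lemma local_mul I x n : (forall a h, I a -> H h -> I (a * h)) ->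
  local P I x -> N n -> local P I (x * n).
Proof.
move=> Iid [s [Hs nPs] Isx] [u [Hu nPu] Hun]; exists (s * u).
  by split; [exact: in_quotientM | exact: tmax_prime].
have -> : s * u * (x * n) = s * x * (u * n) by mulgAC_eq.
exact: Iid.
Qed.

Lemma local_overmonoid : overmonoid N.
Proof.
split=> [|x y]; first exact: local_in.
by apply: local_mul; exact: in_quotientM.
Qed.

Lemma local_inv s : H s -> ~ P s -> exists2 u, N u & s * u = 1.
Proof.
move=> Hs nPs; have [u su] := quotient_inv (tmax_nonzero Pmax nPs).
by exists u => //; exists s => //; rewrite su; exact: in_quotient1.
Qed.

Lemma tmax_nonunit x n : P x -> N n -> x * n <> 1.
Proof.
move=> Px [s [Hs nPs] Hsn] xn; apply: nPs.
have -> : s = x * (s * n) by mulgAC_from s (esym xn).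
exact: tmaxM.
Qed.

Lemma dvd_denom a s x : H s -> ~ P s -> divides N a (s * x) -> divides N a x.
Proof.
move=> Hs nPs [n Nn sxE]; have [u Nu su] := local_inv Hs nPs.
exists (n * u); first exact: local_overmonoid.2.
have xE : x = s * x * u by mulgAC_from x (esym su).
by rewrite {1}xE sxE mulgA.
Qed.

Lemma dvd_local I a x : (forall a h, I a -> H h -> I (a * h)) ->
  local P I a -> divides N a x -> local P I x.
Proof. by move=> Iid Ia [n Nn ->]; exact: local_mul. Qed.

End AtP.

(** The w-ideals, characterized by their localizations; see [widealP]. *)
Definition wideal I := [/\ I `<=` H, (forall z, is_zero z -> I z),
  (forall a h, I a -> H h -> I (a * h)) &
  forall g, (forall P, tmax P -> local P I g) -> I g].

Lemma sub_w X x : X x -> H x -> w X x.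
Proof.
move=> Xx Hx; apply/w_local; split=> // P Pmax; apply: local_in => //.
apply/(gen_idealP _ _ (@overmonoidH M)); left; exists x, 1.
by rewrite mulg1; split=> //; exact: in_quotient1.
Qed.

Lemma w_wideal X : wideal (w X).
Proof.
have HH := @overmonoidH M.
have wH x : w X x -> H x by move=> /w_local[].
split=> [//|z zz|a h Xa Hh|g locg].
- apply/w_local; split=> [|P Pmax]; first exact: zero_in_quotient.
  by apply: local_in => //; apply/gen_idealP => //; right.
- have Ha := wH _ Xa; move/w_local: Xa => [_ loca].
  apply/w_local; split=> [|P Pmax]; first exact: in_quotientM.
  apply: local_mul => //; [|exact: loca|exact: local_in].
  move=> {Ha loca}a {Hh}h /(gen_idealP _ _ HH)[[b [n [Xb Hn ->]]]|za] Hh.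
    apply/(gen_idealP _ _ HH); left; exists b, (n * h).
    by split=> //; [exact: in_quotientM | rewrite mulgA].
  by apply/(gen_idealP _ _ HH); right; exact: zeroM.
- apply/w_local; split=> [|P Pmax].
    by apply: local_globalH => P Pmax; apply: localS (locg P Pmax).
  have [s [Hs nPs] /w_local[_ /(_ P Pmax)]] := locg P Pmax.
  exact: local_denom.
Qed.

Lemma w_min X I : wideal I -> X `<=` I -> w X `<=` I.
Proof.
move=> [IH I0 Iid Iloc] XI x /w_local[_ locx]; apply: Iloc => P Pmax.
apply: localS (locx P Pmax) => y /(gen_idealP _ _ (@overmonoidH M)).
by move=> [[a [h [/XI Ia Hh ->]]]|/I0//]; exact: Iid.
Qed.

Lemma widealP I : r_ideal H w I <-> wideal I.
Proof.
split=> [[_ <-]|]; first exact: w_wideal.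
move=> Iw; have [IH _ _ _] := Iw; split=> //; apply/seteqP; split.
  exact: w_min.
by move=> x Ix; apply: sub_w => //; exact: IH.
Qed.

(** The local form of w-invertibility; see [invertibleP]. *)
Definition invertible I := wideal I /\ forall P, tmax P ->
  exists i g, [/\ I i, (forall y, I y -> H (g * y)) & ~ P (i * g)].

Lemma invertibleP I : r_invertible H w I <-> invertible I.
Proof.
have HH := @overmonoidH M.
split=> [[/widealP Iw IV]|[Iw Iinv]]; split=> //; last 2 first.
- exact/widealP.
- apply/seteqP; split=> x; first by move=> /w_local[].
  move=> Hx; apply/w_local; split=> // P Pmax.
  have [i [g [Ii Ig nPig]]] := Iinv P Pmax.
  exists (i * g); first by split=> //; rewrite cmulgC; exact: Ig.
  apply/(gen_idealP _ _ HH); left; exists (i * g), x; split=> //.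
  by exists i => //; exists g => //; exact/inverseP.
move=> P Pmax; have : w (prodset I (inverse H I)) 1.
  by rewrite IV; exact: in_quotient1.
move=> /w_local[_ /(_ P Pmax)[s [Hs nPs]]]; rewrite mulg1.
move=> /(gen_idealP _ _ HH)[[_ [h [[i Ii [g /inverseP Ig <-]] Hh sE]]]|]; last first.
  by move=> /(tmax_zero Pmax).
exists i, g; split=> // Pig; apply: nPs; rewrite sE; exact: tmaxM.
Qed.

(** If [i g] is outside [P], then [i] generates [I_P], as [i g x = i (g x)]. *)
Lemma invertible_generator I P : invertible I -> tmax P -> exists i,
  [/\ I i, ~ is_zero i & forall x, local P I x -> divides (local P H) i x].
Proof.
move=> [[IH _ _ _] Iinv] Pmax; have [i [g [Ii Ig nPig]]] := Iinv P Pmax.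
have Higs : H (i * g) by rewrite cmulgC; exact: Ig.
exists i; split=> // [|x [s [Hs nPs] Isx]].
  exact: nonzeroMl (tmax_nonzero Pmax nPig).
apply: (dvd_denom Pmax Hs nPs); apply: (dvd_denom Pmax Higs nPig).
exists (g * (s * x)); last by rewrite -mulgA.
by apply: (local_in Pmax); exact: Ig.
Qed.

(** The local witnesses of invertibility can be taken from two finite sets,
    because their products generate [H] under t. *)
Lemma invertible_fin I : invertible I -> exists E E', [/\ finite_set E,
  finite_set E', E `<=` I, (forall g y, E' g -> I y -> H (g * y)) &
  forall P, tmax P -> exists e g, [/\ E e, E' g & ~ P (e * g)]].
Proof.
move=> [[IH _ _ _] Iinv].
pose V := [set x | exists i g, [/\ I i, (forall y, I y -> H (g * y)) & x = i * g]].
have [x|P Pmax|F FV Ftriv] := @inverse_trivial_sub V.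
- by move=> [i [g [Ii Ig ->]]]; rewrite cmulgC; exact: Ig.
- have [i [g [Ii Ig nPig]]] := Iinv P Pmax.
  by exists (i * g) => //; exists i, g.
have /choice[p pP] f : exists p : G * G, F f ->
    [/\ I p.1, (forall y, I y -> H (p.2 * y)) & f = p.1 * p.2].
  have [/FV[i [g Vig]]|nFf] := pselect (F f); last by exists (1, 1).
  by exists (i, g).
have fF : finite_set F by case: Ftriv.
exists [set (p f).1 | f in F], [set (p f).2 | f in F]; split.
- exact: finite_image.
- exact: finite_image.
- by move=> _ [f Ff <-]; have [] := pP f Ff.
- by move=> _ y [f Ff <-]; have [_ + _] := pP f Ff; apply.
move=> P Pmax; have [f Ff nPf] := tmax_inverse_trivial Pmax Ftriv.
exists (p f).1, (p f).2; split; [by exists f | by exists f |].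
by have [_ _ <-] := pP f Ff.
Qed.

(** If no product of an element of [E] with an element of the finite generating
    sets [A'] of [I^-1] and [B'] of [J^-1] avoided [P], these products would
    form a finite subset of [P]. But its inverse is [H]: if [q c e] is in [H] for
    all [e] in [A'] and [B'], then [q c] is in [I] and [J]. Now if [c e] avoids
    [P] and [e] is in [I^-1], then [c e I] is contained in [c H], hence in [J];
    symmetrically for [J^-1]. *)
Lemma invertible_comparable I J E P :
    invertible I -> invertible J -> finite_set E -> E `<=` I `&` J ->
    (forall q, (forall c, E c -> (I `&` J) (q * c)) -> H q) -> tmax P ->
  local P I `<=` local P J \/ local P J `<=` local P I.
Proof.
move=> Iinv Jinv fE EIJ Eq Pmax.
have [A [A' [fA fA' AI A'I AP]]] := invertible_fin Iinv.
have [B [B' [fB fB' BJ B'J BP]]] := invertible_fin Jinv.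
have memV K D D' : wideal K -> D `<=` K ->
    (forall Q, tmax Q -> exists e g, [/\ D e, D' g & ~ Q (e * g)]) ->
    (forall g y, D' g -> K y -> H (g * y)) ->
    forall x, (forall g, D' g -> H (x * g)) -> K x.
  move=> [KH _ Kid Kloc] DK DP D'K x xD'; apply: Kloc => Q Qmax.
  have [e [g [De D'g nQeg]]] := DP Q Qmax; exists (e * g).
    by split=> //; rewrite cmulgC; apply: D'K => //; exact: DK.
  have -> : e * g * x = e * (x * g) by mulgAC_eq.
  by apply: Kid; [exact: DK | exact: xD'].
have triv : inverse_trivial [set c * e | c in E & e in A' `|` B'].
  split=> [_ [c /EIJ[Ic Jc] [e [A'e|B'e] <-]]||q qE].
  - by rewrite cmulgC; exact: A'I.
  - by rewrite cmulgC; exact: B'J.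
  - by apply: finite_image2 => //; rewrite finite_setU.
  apply: Eq => c Ec; split.
    apply: (memV _ A A') => // [|e A'e]; first by case: Iinv.
    by rewrite -mulgA; apply: qE; exists c => //; exists e => //; left.
  apply: (memV _ B B') => // [|e B'e]; first by case: Jinv.
  by rewrite -mulgA; apply: qE; exists c => //; exists e => //; right.
have [_ [c /EIJ[Ic Jc] [e A'B'e <-]] nPce] := tmax_inverse_trivial Pmax triv.
have [[_ _ Iid _] _] := Iinv; have [[_ _ Jid _] _] := Jinv.
case: A'B'e => [A'e|B'e]; [left|right] => x [s [Hs nPs] sx].
  have Hce : H (c * e) by rewrite cmulgC; exact: A'I.
  exists (c * e * s); first by split; [exact: in_quotientM | exact: tmax_prime].
  have -> : c * e * s * x = c * (e * (s * x)) by mulgAC_eq.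
  by apply: Jid => //; exact: A'I.
have Hce : H (c * e) by rewrite cmulgC; exact: B'J.
exists (c * e * s); first by split; [exact: in_quotientM | exact: tmax_prime].
have -> : c * e * s * x = c * (e * (s * x)) by mulgAC_eq.
by apply: Iid => //; exact: B'J.
Qed.


(** * Radical ideals and their products *)

Definition radical_closed I :=
  forall x n, H x -> (0 < n)%N -> I (x ^+ n) -> I x.

Definition invertible_radical I := invertible I /\ radical_closed I.

Lemma radicalE I : wideal I -> radical H I = I <-> radical_closed I.
Proof.
move=> [IH _ _ _]; split=> [<- x n Hx n0 [Hxn [m m0 Ixnm]]|Irad].
  by split=> //; exists (n * m)%N; rewrite ?muln_gt0 ?n0 // expgnA.
apply/seteqP; split=> [x [Hx [n n0 Ixn]]|x Ix]; first exact: Irad Ixn.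
by split; [exact: IH | exists 1%N].
Qed.

Lemma radical_r_idealP I :
  radical_r_ideal H w I <-> wideal I /\ radical_closed I.
Proof.
by split=> [[/widealP Iw /(radicalE Iw)]|[Iw /(radicalE Iw)]]; split=> //;
  exact/widealP.
Qed.

Lemma local_radical I P x n : tmax P ->
    (forall a h, I a -> H h -> I (a * h)) -> radical_closed I ->
  local P H x -> (0 < n)%N -> local P I (x ^+ n) -> local P I x.
Proof.
move=> Pmax Iid Irad [u [Hu nPu] Hux] n0 [s [Hs nPs] Isxn].
exists (s * u); first by split; [exact: in_quotientM | exact: tmax_prime].
have Hsux : H (s * u * x) by rewrite -mulgA; exact: in_quotientM.
apply: (Irad _ n) => //; case: n n0 Isxn => // n _ Isxn.
have -> : (s * u * x) ^+ n.+1 = s * x ^+ n.+1 * (s ^+ n * u ^+ n.+1).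
  by rewrite !expgMnC (expgSC s); mulgAC_eq.
by apply: Iid => //; apply: in_quotientM; exact: in_quotientX.
Qed.

Definition locally_comparable := forall I J P,
  invertible_radical I -> invertible_radical J -> tmax P ->
  local P I `<=` local P J \/ local P J `<=` local P I.

(** At [P], the smaller of [I_P] and [J_P] is also [(I `&` J)_P], and the inverse
    of the corresponding ideal is contained in that of the intersection. *)
Lemma invertible_radicalI I J : locally_comparable ->
  invertible_radical I -> invertible_radical J -> invertible_radical (I `&` J).
Proof.
move=> cmp IIr JIr; have [[Iw Iinv] Irad] := IIr; have [[Jw Jinv] Jrad] := JIr.
have [IH I0 Iid Iloc] := Iw; have [JH J0 Jid Jloc] := Jw.
split; last first.
  by move=> x n Hx n0 [Ixn Jxn]; split; [exact: Irad Ixn | exact: Jrad Jxn].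
split=> [|P Pmax].
  split=> [x [/IH//]|z zz|a h [Ia Ja] Hh|g locg].
  - by split; [exact: I0 | exact: J0].
  - by split; [exact: Iid | exact: Jid].
  - split; [apply: Iloc|apply: Jloc] => P Pmax;
      apply: (localS _ (locg P Pmax)); [exact: subIsetl|exact: subIsetr].
have [IJ|JI] := cmp I J P IIr JIr Pmax.
  have [i [g [Ii Ig nPig]]] := Iinv P Pmax.
  have [s [Hs nPs] Jsi] := IJ i (local_in Pmax Ii).
  exists (s * i), g; split; [|by move=> y [+ _]; exact: Ig|].
    by split=> //; rewrite cmulgC; exact: Iid.
  rewrite -mulgA; apply: tmax_prime => //.
  by rewrite cmulgC; exact: Ig.
have [i [g [Ji Jg nPig]]] := Jinv P Pmax.
have [s [Hs nPs] Isi] := JI i (local_in Pmax Ji).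
exists (s * i), g; split; [|by move=> y [_ +]; exact: Jg|].
  by split=> //; rewrite cmulgC; exact: Jid.
rewrite -mulgA; apply: tmax_prime => //.
by rewrite cmulgC; exact: Jg.
Qed.

Local Notation bigprodset n I := (\big[@prodset _/[set 1]]_(i < n) I i).

Lemma bigprodsetP n (I : 'I_n -> set G) x :
  bigprodset n I x <->
  exists2 f : 'I_n -> G, (forall i, I i (f i)) & x = \big[mul/1]_(i < n) f i.
Proof.
elim: n I x => [|n IHn] I x.
  rewrite big_ord0; split=> [->|[f _ ->]]; last by rewrite big_ord0.
  by exists (fun=> 1); rewrite ?big_ord0 // => -[].
rewrite big_ord_recl; split=> [[a Ia [y /IHn[f If ->] <-]]|[f If ->]].
  exists (fun i => if unlift ord0 i is Some j then f j else a).
    by move=> i; case: unliftP => [j ->|->].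
  rewrite big_ord_recl unlift_none; congr (_ * _).
  by apply: eq_bigr => i _; rewrite liftK.
rewrite big_ord_recl; exists (f ord0) => //.
exists (\big[mul/1]_(i < n) f (lift ord0 i)) => //.
by apply/IHn; exists (fun i => f (lift ord0 i)).
Qed.

Lemma big_const_expg n y : \big[mul/1]_(i < n) y = y ^+ n.
Proof. by elim: n => [|n IHn]; rewrite ?big_ord0 // big_ord_recl IHn expgSC. Qed.

Lemma bigprodset_swap n (I : 'I_n -> set G) (f : 'I_n -> G) k b :
    (forall i, I i (f i)) -> I k b ->
  bigprodset n I (b * \big[mul/1]_(i < n | i != k) f i).
Proof.
move=> If Ib; apply/bigprodsetP.
exists (fun i => if i == k then b else f i).
  by move=> i; case: eqP => [->|].
rewrite [RHS](bigD1 k) //= eqxx; congr (_ * _).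
by apply: eq_bigr => i /negbTE->.
Qed.

Lemma bigprodset_ideal n (I : 'I_n.+1 -> set G) x h :
    (forall i, wideal (I i)) ->
  bigprodset n.+1 I x -> H h -> bigprodset n.+1 I (x * h).
Proof.
move=> Iw /bigprodsetP[f If ->] Hh; rewrite (bigD1 ord0) //=.
rewrite cmulgAC; apply: bigprodset_swap => //.
by have [_ _ Iid _] := Iw ord0; exact: Iid.
Qed.

Lemma bigprodset_sub n (I : 'I_n -> set G) k :
  (forall i, wideal (I i)) -> bigprodset n I `<=` I k.
Proof.
move=> Iw x /bigprodsetP[f If ->]; rewrite (bigD1 k) //=.
have [_ _ Iid _] := Iw k; apply: Iid => //.
apply: (big_ind (fun x => H x)) => [||i _]; first exact: in_quotient1.
  by move=> ? ?; exact: in_quotientM.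
by have [IH _ _ _] := Iw i; exact: IH.
Qed.

Lemma bigprodsetH n (I : 'I_n -> set G) :
  (forall i, wideal (I i)) -> bigprodset n I `<=` H.
Proof.
move=> Iw x /bigprodsetP[f If ->].
apply: (big_ind (fun x => H x)) => [||i _]; first exact: in_quotient1.
  by move=> ? ?; exact: in_quotientM.
by have [IH _ _ _] := Iw i; exact: IH.
Qed.

Lemma gen_ideal1P x y : gen_ideal H [set x] y <->
  (exists2 h, H h & y = x * h) \/ is_zero y.
Proof.
rewrite gen_idealP; last exact: overmonoidH; split.
  by move=> [[_ [h [-> Hh ->]]]|]; [left; exists h | right].
by move=> [[h Hh ->]|]; [left; exists x, h | right].
Qed.

Definition principal_radical x := radical H (gen_ideal H [set x]).

Lemma gen_ideal1_wideal x : H x -> wideal (gen_ideal H [set x]).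
Proof.
move=> Hx; split=> [y|z zz|a h|g locg].
- by move=> /gen_ideal1P[[h Hh ->]|]; [exact: in_quotientM|exact: zero_in_quotient].
- by apply/gen_ideal1P; right.
- move=> /gen_ideal1P[[k Hk ->]|za] Hh; apply/gen_ideal1P.
    by left; exists (k * h); [exact: in_quotientM | rewrite mulgA].
  by right; exact: zeroM.
apply/gen_ideal1P; have [zg|zg] := pselect (is_zero g); first by right.
have sgE P : tmax P -> exists s h, [/\ H s, ~ P s, H h & s * g = x * h].
  move=> Pmax; have [s [Hs nPs] /gen_ideal1P[[h Hh sg]|]] := locg P Pmax.
    by exists s, h.
  by move=> /(is_zeroM (tmax_nonzero Pmax nPs) zg).
have [zx|zx] := pselect (is_zero x).
  have [P Pmax _] : exists2 P, tmax P & set0 `<=` P.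
    apply: tmax_exists => // -[F F0 [_ _ Fq]].
    apply: HG; apply/seteqP; split=> // q _.
    by apply: Fq => f /F0.
  have [s [h [Hs nPs Hh sg]]] := sgE P Pmax.
  by case: (is_zeroM (tmax_nonzero Pmax nPs) zg); rewrite sg; exact: zeroM.
left; have [y xy] := quotient_inv zx; exists (y * g); last first.
  by rewrite mulgA xy mul1g.
apply: local_globalH => P Pmax; have [s [h [Hs nPs Hh sg]]] := sgE P Pmax.
exists s => //; have -> : s * (y * g) = h; last by [].
by rewrite -[RHS]mul1g -xy; mulgAC_from y sg.
Qed.

Lemma principal_radicalP x y : H x ->
  principal_radical x y <-> H y /\ exists n, (0 < n)%N /\ exists2 h, H h & y ^+ n = x * h.
Proof.
move=> Hx; split=> [[Hy [n n0]]|[Hy [n [n0 [h Hh yn]]]]]; last first.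
  by split=> //; exists n => //; apply/gen_ideal1P; left; exists h.
move=> /gen_ideal1P[[h Hh yn]|zyn]; split=> //; first by exists n; split=> //; exists h.
have zy : is_zero y by apply: contrapT => /(@nonzeroX _ _ n).
exists 1%N; split=> //; exists y => //.
by rewrite cmulgC zy.
Qed.

(** Locally [x] is a product with a factor in [I k]; dividing the other factors
    by [x] gives an element of the inverse of [I k]. *)
Lemma principal_factor_invertible n (I : 'I_n -> set G) x k : ~ is_zero x ->
    H x -> (forall i, wideal (I i)) ->
  gen_ideal H [set x] = w (bigprodset n I) -> invertible (I k).
Proof.
move=> x0 Hx Iw xE; split=> // P Pmax; have [y xy] := quotient_inv x0.
have : w (bigprodset n I) x.
  rewrite -xE; apply/gen_ideal1P; left; exists 1; first exact: in_quotient1.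
  by rewrite mulg1.
move=> /w_local[_ /(_ P Pmax)[s [Hs nPs]]].
rewrite gen_idealP; last exact: overmonoidH.
move=> [[_ [h [/bigprodsetP[f If ->] Hh sx]]]|]; last first.
  by move=> /(is_zeroM (tmax_nonzero Pmax nPs) x0).
move: sx; rewrite (bigD1 k) //=; set r := \big[mul/1]_(i < n | _) _ => sx.
exists (f k), (r * h * y); split; first exact: If.
  move=> b Ib; have : gen_ideal H [set x] (b * r).
    have Ibr := bigprodset_swap If Ib.
    by rewrite xE; apply: sub_w => //; exact: bigprodsetH Ibr.
  move=> /gen_ideal1P[[c Hc br]|zbr].
    suff -> : r * h * y * b = c * h by exact: in_quotientM.
    transitivity (b * r * (h * y)); first mulgAC_eq.
    by rewrite br; mulgAC_from (c * h) xy.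
  have -> : r * h * y * b = b * r * (h * y) by mulgAC_eq.
  by apply: zero_in_quotient; exact: zeroM.
suff -> : f k * (r * h * y) = s by [].
transitivity (f k * r * h * y); first mulgAC_eq.
by rewrite -sx; mulgAC_from s xy.
Qed.

(** The product contains the powers of exponent [n.+1] of the elements of the
    intersection, and is contained in each factor. *)
Lemma principal_radical_bigcap n (I : 'I_n.+1 -> set G) x :
    H x -> (forall i, wideal (I i)) -> (forall i, radical_closed (I i)) ->
  gen_ideal H [set x] = w (bigprodset n.+1 I) ->
  principal_radical x = [set y | H y /\ forall i, I i y].
Proof.
move=> Hx Iw Irad xE; apply/seteqP; split=> [y [Hy [m m0]]|y [Hy Iy]].
  rewrite xE => wym; split=> // i; apply: (Irad i _ m) => //.
  by apply: (w_min (Iw i) _ wym); exact: bigprodset_sub.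
split=> //; exists n.+1 => //; rewrite xE.
apply: sub_w; last exact: in_quotientX.
by apply/bigprodsetP; exists (fun=> y) => //; rewrite big_const_expg.
Qed.

Lemma wideal_full : wideal H.
Proof.
split=> // [||g]; [exact: zero_in_quotient | exact: in_quotientM |].
exact: local_globalH.
Qed.

Lemma invertible_radical_bigcap n (I : 'I_n -> set G) : locally_comparable ->
    (forall i, invertible_radical (I i)) ->
  invertible_radical [set y | H y /\ forall i, I i y].
Proof.
move=> cmp; elim: n I => [|n IHn] I Ir.
  have -> : [set y | H y /\ forall i : 'I_0, I i y] = H.
    by apply/seteqP; split=> [y []//|y Hy]; split=> // -[].
  split=> //; split=> [|P Pmax]; first exact: wideal_full.
  exists 1, 1; rewrite mulg1; split; first exact: in_quotient1.
    by move=> y; rewrite mul1g.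
  exact: tmax1.
have -> : [set y | H y /\ forall i, I i y] =
    I ord0 `&` [set y | H y /\ forall i, I (lift ord0 i) y].
  apply/seteqP; split=> [y [Hy Iy]//|y [I0y [Hy Iy]]]; split=> // i.
  by case: (unliftP ord0 i) => [j ->|->].
by apply: invertible_radicalI => //; exact: IHn.
Qed.

Definition radical_factorial :=
  forall x, H x -> radical_r_product H w (gen_ideal H [set x]).

Definition radicals_invertible :=
  forall x, H x -> ~ is_zero x -> invertible_radical (principal_radical x).

(** The radical of [x H] is the intersection of the factors of [x H]. *)
Lemma comparable_radicals_invertible :
  locally_comparable -> radical_factorial -> radicals_invertible.
Proof.
move=> cmp rf x Hx x0; have [n [I [Irad xE]]] := rf x Hx.
have Iw i : wideal (I i) by have /radical_r_idealP[] := Irad i.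
have Ir i : radical_closed (I i) by have /radical_r_idealP[] := Irad i.
rewrite (principal_radical_bigcap Hx Iw Ir xE).
apply: invertible_radical_bigcap => // i; split=> //.
exact: principal_factor_invertible xE.
Qed.

(** * Comparability of radical ideals *)

Lemma SP_radical_factorial : SP_monoid H w -> radical_factorial.
Proof. by move=> sp x Hx; apply/sp/widealP; exact: gen_ideal1_wideal. Qed.

(** Let [a] and [b] generate [I] and [J] at [P], and factor the w-ideal [X]
    generated by [a] and [b ^+ 2]. The factors are radical, so they contain [b].
    Up to a factor outside [P], [a] is a product of elements [f k] of the
    factors of [X], and replacing [f k] by [b] gives an element of [X], which is
    locally a multiple of [a] or of [b ^+ 2]. In the first case [f k] divides
    [b], in the second case [b] divides [a]. Finally, if every [f k] divides [b],
    then [a] divides a power of [b], which is therefore in the radical ideal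
    [I]. *)
Lemma SP_locally_comparable : SP_monoid H w -> locally_comparable.
Proof.
move=> sp I J P [Iinv Irad] [Jinv Jrad] Pmax.
have [a [Ia a0 aI]] := invertible_generator Iinv Pmax.
have [b [Jb b0 bJ]] := invertible_generator Jinv Pmax.
have [[IH _ Iid _] _] := Iinv; have [[JH _ Jid _] _] := Jinv.
have N_ := local_overmonoid Pmax; have HH := @overmonoidH M.
have [ba|nba] := pselect (divides (local P H) b a).
  left=> x /aI ax; apply: (dvd_local Pmax Jid (local_in Pmax Jb)).
  exact: (dvd_trans N_ ba ax).
have [Ha Hb] := (IH _ Ia, JH _ Jb).
have Hbb : H (b ^+ 2) by exact: in_quotientX.
pose X := w [set a; b ^+ 2].
have Xw : wideal X by exact: w_wideal.
have [n [K [Krad XE]]] := sp X ((widealP X).2 Xw).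
have Kw i : wideal (K i) by have /radical_r_idealP[] := Krad i.
have Kr i : radical_closed (K i) by have /radical_r_idealP[] := Krad i.
have XK i : X `<=` K i by rewrite XE; apply: w_min => //; exact: bigprodset_sub.
have Kb i : K i b.
  apply: (Kr i b 2) => //; apply: XK.
  by apply: sub_w => //; right.
have /w_local[_ /(_ P Pmax)[s [Hs nPs]]] : w (bigprodset n.+1 K) a.
  by rewrite -/(r_product _ _ _) -XE; apply: sub_w => //; left.
have s0 := tmax_nonzero Pmax nPs; have sa0 := is_zeroM s0 a0.
move=> /(gen_idealP _ _ HH)[[y [h [Ky Hh sa]]]|/sa0//].
have /bigprodsetP[f Kf saE] := bigprodset_ideal Kw Ky Hh.
rewrite -{}sa {y Ky h Hh} in saE.
have fb k : divides (local P H) (f k) b.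
  move: (saE); rewrite (bigD1 k) //=; set r := \big[mul/1]_(i < _ | _) _ => saE'.
  have : X (b * r).
    have Kbr := bigprodset_swap Kf (Kb k).
    by rewrite XE; apply: sub_w => //; exact: bigprodsetH Kbr.
  move=> /w_local[_ /(_ P Pmax)[u [Hu nPu]]] /(gen_idealP _ _ HH).
  have u0 := tmax_nonzero Pmax nPu.
  move=> [[_ [m [[->|->] Hm ubr]]]|]; last first.
  - move/(is_zeroM u0); case => /(is_zeroM b0); case.
    by move=> zr; apply: sa0; rewrite saE'; exact: zeroMr.
  - case: nba; apply: (dvd_denom Pmax Hu nPu); apply: (dvd_denom Pmax Hs nPs).
    exists (m * f k).
      apply: N_.2; apply: local_in => //.
      by have [KH _ _ _] := Kw k; exact: KH.
    apply: (cmulg_inj b0).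
    transitivity (u * (b * r) * f k); first by mulgAC_from (b * u) saE'.
    by rewrite ubr expg2; mulgAC_eq.
  - apply: (dvd_denom Pmax Hs nPs); apply: (dvd_denom Pmax Hu nPu).
    exists m; first exact: local_in.
    apply: (cmulg_inj a0).
    transitivity (u * (b * r) * f k); first by mulgAC_from (u * b) saE'.
    by rewrite ubr; mulgAC_eq.
right=> x /bJ bx; apply: (dvd_local Pmax Iid) bx.
apply: (@local_radical _ _ _ n.+1 Pmax Iid Irad) => //; first exact: local_in.
apply: (@dvd_local _ Pmax I (s * a)) => //.
  by apply: local_in => //; rewrite cmulgC; exact: Iid.
rewrite saE -big_const_expg; move: f fb {Kf saE} => f fb.
elim: (n.+1) f fb => [|k IHk] f fb.
  by rewrite !big_ord0; exact: dvd_refl.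
by rewrite !big_ord_recl; apply: dvd_mul => //; exact: IHk.
Qed.

(** For [i] in the first factor and [y] in the product of the others, the square
    of [z := q ^+ k * (i * y)] is [i] times an element of [H]. So [z] is in the
    first factor, which is radical, and as this factor is invertible,
    [q ^+ k * y] is in [H]. Hence the factors can be removed one by one. *)
Lemma almost_integral_bigprodset n (I : 'I_n -> set G) q :
    (forall i, invertible_radical (I i)) ->
    (forall k y, bigprodset n I y -> H (q ^+ k * y)) ->
  forall k, H (q ^+ k).
Proof.
elim: n I => [|n IHn] I Ir qI.
  by move=> k; rewrite -[_ ^+ _]mulg1; apply: qI; rewrite big_ord0.
apply: (IHn (fun i => I (lift ord0 i))) => // k y Iy.
have [[[IH _ Iid _] Iinv] Irad] := Ir ord0.
have qI' j a b : I ord0 a -> bigprodset n (fun i => I (lift ord0 i)) b ->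
    H (q ^+ j * (a * b)).
  by move=> Ia Ib; apply: qI; rewrite big_ord_recl; exists a => //; exists b.
apply: local_globalH => P Pmax; have [i [g [Ii Ig nPig]]] := Iinv P Pmax.
exists (i * g); first by split=> //; rewrite cmulgC; exact: Ig.
have -> : i * g * (q ^+ k * y) = g * (q ^+ k * (i * y)) by mulgAC_eq.
apply: Ig; apply: (Irad _ 2) => //; first exact: qI'.
have -> : (q ^+ k * (i * y)) ^+ 2 = i * (y * (q ^+ (k + k) * (i * y))).
  by rewrite expg2 (expgDC q); mulgAC_eq.
apply: Iid => //; apply: in_quotientM; last exact: qI'.
have Iw j : wideal (I (lift ord0 j)) by have [[]] := Ir (lift ord0 j).
exact: bigprodsetH Iy.
Qed.

(** [H] is completely integrally closed. *)
Lemma radical_factorial_almost_integral q c : radical_factorial -> H c ->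
  ~ is_zero c -> (forall k, H (q ^+ k * c)) -> H q.
Proof.
move=> rf Hc c0 qc; have [n [I [Irad cE]]] := rf c Hc.
have Iw i : wideal (I i) by have /radical_r_idealP[] := Irad i.
have Ir i : radical_closed (I i) by have /radical_r_idealP[] := Irad i.
rewrite -[q]expg1; apply: (@almost_integral_bigprodset _ I) => [i|k y Iy].
  by split=> //; exact: principal_factor_invertible cE.
have : gen_ideal H [set c] y.
  by rewrite cE; apply: sub_w => //; exact: bigprodsetH Iy.
move=> /gen_ideal1P[[h Hh ->]|zy]; last exact/zero_in_quotient/zeroMr.
by rewrite mulgA; exact: in_quotientM.
Qed.

(** The set [E] generates [I `&` J] under w: locally [I] and [J] are generated
    by elements [e] and [f] of the finite sets [A] and [B], and the finite
    conductor property provides generators of [e H `&` f H]. *)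
Lemma finite_conductor_setI I J : finite_conductor_monoid H w ->
    invertible I -> invertible J -> exists E, [/\ finite_set E, E `<=` I `&` J &
  forall q, (forall c, E c -> (I `&` J) (q * c)) ->
    forall c, (I `&` J) c -> (I `&` J) (q * c)].
Proof.
move=> fc Iinv Jinv.
have [A [A' [fA fA' AI A'I AP]]] := invertible_fin Iinv.
have [B [B' [fB fB' BJ B'J BP]]] := invertible_fin Jinv.
have [[IH I0 Iid Iloc] _] := Iinv; have [[JH J0 Jid Jloc] _] := Jinv.
pose L e f := prodset [set e] H `&` prodset [set f] H.
have /choice[S SP] (ef : G * G) : exists S, A ef.1 -> B ef.2 ->
    [/\ S `<=` L ef.1 ef.2, finite_set S & L ef.1 ef.2 = w S].
  have [Ae|] := pselect (A ef.1); last by exists set0.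
  have [Bf|] := pselect (B ef.2); last by exists set0.
  by have [_ [E]] := fc _ _ (IH _ (AI _ Ae)) (JH _ (BJ _ Bf)); exists E.
have LIJ e f x : A e -> B f -> L e f x -> (I `&` J) x.
  move=> Ae Bf [[_ -> [h Hh <-]] [_ -> [k Hk ehk]]]; split.
    by apply: Iid => //; exact: AI.
  by rewrite -ehk; apply: Jid => //; exact: BJ.
have IJid a h : (I `&` J) a -> H h -> (I `&` J) (a * h).
  by move=> [Ia Ja] Hh; split; [exact: Iid | exact: Jid].
exists (\bigcup_(ef in A `*` B) S ef); split=> [||q qS c [Ic Jc]].
- by apply: bigcup_finite; [exact: finite_setX|move=> ef [Ae Bf]; have [] := SP ef Ae Bf].
- move=> x [ef [Ae Bf] Sx]; have [SL _ _] := SP ef Ae Bf.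
  exact: LIJ Ae Bf (SL _ Sx).
suff loc P : tmax P -> local P (I `&` J) (q * c).
  by split; [apply: Iloc|apply: Jloc] => P Pmax; apply: localS (loc P Pmax);
    [exact: subIsetl|exact: subIsetr].
move=> Pmax; have [e [g [Ae A'g nPeg]]] := AP P Pmax.
have [f [k [Bf B'k nPfk]]] := BP P Pmax.
have [Heg Hfk] : H (e * g) /\ H (f * k).
  by split; rewrite cmulgC; [apply: A'I|apply: B'J] => //; [exact: AI|exact: BJ].
apply: (local_denom Pmax Heg nPeg); apply: (local_denom Pmax Hfk nPfk).
have [_ _ LE] := SP (e, f) Ae Bf.
have : L e f (e * g * (f * k) * c).
  split.
    exists e => //; exists (g * c * (f * k)); last mulgAC_eq.
    by apply: in_quotientM => //; exact: A'I.
  exists f => //; exists (k * c * (e * g)); last mulgAC_eq.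
  by apply: in_quotientM => //; exact: B'J.
rewrite LE => /w_local[_ /(_ P Pmax)[s [Hs nPs]]] /gen_idealP.
move=> /(_ (@overmonoidH M))[[x [h [Sx Hh sE]]]|zsc].
  apply: (local_denom Pmax Hs nPs).
  have -> : s * (f * k * (e * g * (q * c))) = q * x * h by mulgAC_from q sE.
  apply: local_in => //; apply: IJid => //; apply: qS.
  by exists (e, f).
have zc : is_zero c.
  apply: contrapT => nzc; move: zsc; apply: is_zeroM; first exact: tmax_nonzero nPs.
  apply: is_zeroM => //.
  by apply: is_zeroM; [exact: tmax_nonzero nPeg|exact: tmax_nonzero nPfk].
apply: local_in => //.
by split; [apply: I0|apply: J0]; do 3!apply: zeroMr.
Qed.

Lemma finite_conductor_locally_comparable :
  finite_conductor_monoid H w -> radical_factorial -> locally_comparable.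
Proof.
move=> fc rf I J P [Iinv Irad] [Jinv Jrad] Pmax.
have [E [fE EIJ Eq]] := finite_conductor_setI fc Iinv Jinv.
have [a [Ia a0 _]] := invertible_generator Iinv Pmax.
have [b [Jb b0 _]] := invertible_generator Jinv Pmax.
have [[IH _ Iid _] _] := Iinv; have [[JH _ Jid _] _] := Jinv.
apply: (invertible_comparable Iinv Jinv fE EIJ) => // q /Eq qIJ.
have IJab : (I `&` J) (a * b).
  by split; [apply: Iid => //; exact: JH | rewrite cmulgC; apply: Jid => //; exact: IH].
apply: (@radical_factorial_almost_integral _ (a * b) rf).
- by apply: in_quotientM; [exact: IH | exact: JH].
- exact: is_zeroM.
move=> k; suff : (I `&` J) (q ^+ k * (a * b)) by move=> [/IH].
by elim: k => [|k IHk]; rewrite ?mul1g // expgSC -mulgA; exact: qIJ.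
Qed.
(** * Discrete valuation monoids *)

Section DiscreteValuation.
Variable N : set G.
Hypothesis N_ : overmonoid N.
Local Notation "a %| b" := (divides N a b).

Definition radical_elt r :=
  forall x n, N x -> (0 < n)%N -> r %| x ^+ n -> r %| x.

(** A generator of the maximal ideal of a discrete valuation monoid [N]. *)
Definition uniformizer p := [/\ N p, ~ is_zero p, ~ p %| 1 &
  forall x, N x -> ~ is_zero x -> exists k, x %| p ^+ k /\ p ^+ k %| x].

Definition dvd_total := forall x y, N x -> N y -> x %| y \/ y %| x.

Lemma overmonoid1 : N 1. Proof. by apply: N_.1; exact: in_quotient1. Qed.

Lemma overmonoidX x n : N x -> N (x ^+ n).
Proof.
move=> Nx; elim: n => [|n IHn]; first exact: overmonoid1.
by rewrite expgSC; exact: N_.2.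
Qed.

Lemma dvd_exp a b n : a %| b -> a ^+ n %| b ^+ n.
Proof.
move=> ab; elim: n => [|n IHn]; first exact: dvd_refl.
by rewrite !expgSC; exact: dvd_mul.
Qed.

Lemma dvd_exp2 a m n : N a -> (m <= n)%N -> a ^+ m %| a ^+ n.
Proof.
move=> Na mn; exists (a ^+ (n - m)); first exact: overmonoidX.
by rewrite -expgDC subnKC.
Qed.

Lemma dvd_zero x z : is_zero z -> x %| z.
Proof.
move=> zz; exists z; last by rewrite cmulgC zz.
by apply: N_.1; exact: zero_in_quotient.
Qed.

Lemma uniformizer_total p : uniformizer p -> dvd_total.
Proof.
move=> [Np p0 _ px] x y Nx Ny.
have [zx|x0] := pselect (is_zero x); first by right; exact: dvd_zero.
have [zy|y0] := pselect (is_zero y); first by left; exact: dvd_zero.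
have [k [xk kx]] := px x Nx x0; have [l [yl ly]] := px y Ny y0.
have [kl|/ltnW lk] := leqP k l; [left|right].
  exact: (dvd_trans N_ xk (dvd_trans N_ (dvd_exp2 Np kl) ly)).
exact: (dvd_trans N_ yl (dvd_trans N_ (dvd_exp2 Np lk) kx)).
Qed.

Lemma DVM_total : DVM N -> dvd_total.
Proof.
move=> [_ Npr] x y Nx Ny.
have [|A [AN A1 XE]] := Npr (gen_ideal N [set x; y]).
  have zN z : is_zero z -> N z by move=> zz; apply: N_.1; exact: zero_in_quotient.
  split=> [z|]; first by move=> /(gen_idealP _ _ N_)[[a [n [[->|->] Nn ->]]]|/zN//];
    exact: N_.2.
  apply/seteqP; split=> z zX; apply/(gen_idealP _ _ N_).
    left; exists z, 1; rewrite mulg1; split=> //; exact: overmonoid1.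
  move: zX => /(gen_idealP _ _ N_)[[a [n [aX Nn ->]]]|]; last by right.
  move: aX => /(gen_idealP _ _ N_)[[b [m [bX Nm ->]]]|za]; last first.
    by right; exact: zeroM.
  by left; exists b, (m * n); split=> //; [exact: N_.2|rewrite mulgA].
have inX z : [set x; y] z -> is_zero z \/ exists2 c, A c & c %| z.
  move=> xyz; have : gen_ideal N [set x; y] z.
    apply/(gen_idealP _ _ N_); left; exists z, 1; rewrite mulg1.
    by split=> //; exact: overmonoid1.
  rewrite XE => /(gen_idealP _ _ N_)[[c [n [Ac Nn ->]]]|]; last by left.
  by right; exists c => //; exists n.
have [zx|[c Ac cx]] := inX x (or_introl erefl); first by right; exact: dvd_zero.
have [zy|[d Ad dy]] := inX y (or_intror erefl); first by left; exact: dvd_zero.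
have dc : d = c by exact: A1. rewrite {d Ad}dc in dy.
have : gen_ideal N [set x; y] c.
  rewrite XE; apply/(gen_idealP _ _ N_); left; exists c, 1.
  by rewrite mulg1; split=> //; exact: overmonoid1.
move=> /(gen_idealP _ _ N_)[[_ [n [[->|->] Nn cE]]]|zc].
- by left; apply: (dvd_trans N_) dy; exists n.
- by right; apply: (dvd_trans N_) cx; exists n.
- by left; apply: dvd_zero; case: dy => n _ ->; exact: zeroM.
Qed.

(** In a nonzero s-ideal, an element associated with the least possible power
    of [p] is a generator. *)
Lemma uniformizer_DVM p : uniformizer p -> DVM N.
Proof.
move=> [Np p0 p1 px]; split=> [NQ|X [XN XE]].
  apply: p1; have [q pq] := quotient_inv p0; exists q; last by rewrite pq.
  by rewrite NQ quotientE.
have Xid x n : X x -> N n -> X (x * n).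
  by move=> Xx Nn; rewrite XE; apply/(gen_idealP _ _ N_); left; exists x, n.
have X0 z : is_zero z -> X z.
  by move=> zz; rewrite XE; apply/(gen_idealP _ _ N_); right.
have [[x0 [Xx0 nz0]]|Xz] := pselect (exists x, X x /\ ~ is_zero x); last first.
  exists set0; split=> //; apply/seteqP; split=> x.
    move=> Xx; apply/(gen_idealP _ _ N_); right.
    by apply: contrapT => nzx; apply: Xz; exists x.
  by move=> /(gen_idealP _ _ N_)[[a [n []]]|/X0].
pose vals k := `[< exists x, [/\ X x, x %| p ^+ k & p ^+ k %| x] >].
have : exists k, vals k.
  have [k [xk kx]] := px x0 (XN _ Xx0) nz0.
  by exists k; apply/asboolP; exists x0.
move=> /ex_minnP[k /asboolP[x [Xx xk kx]] kmin].
exists [set x]; split=> [_ ->|_ _ -> ->//|]; first exact: XN.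
apply/seteqP; split=> y; last first.
  move=> /(gen_idealP _ _ N_)[[_ [n [-> Nn ->]]]|/X0//]; exact: Xid.
move=> Xy; apply/(gen_idealP _ _ N_).
have [zy|y0] := pselect (is_zero y); [by right | left].
have [l [yl ly]] := px y (XN _ Xy) y0.
have kl : (k <= l)%N by apply: kmin; apply/asboolP; exists y.
have [n Nn yE] := dvd_trans N_ xk (dvd_trans N_ (dvd_exp2 Np kl) ly).
by exists x, n.
Qed.

Hypothesis radical_dvd : forall x, N x -> ~ is_zero x -> exists r,
  [/\ N r, radical_elt r, r %| x & exists2 n, (0 < n)%N & x %| r ^+ n].
Hypothesis radical_total : forall r s, N r -> N s -> ~ is_zero r ->
  ~ is_zero s -> radical_elt r -> radical_elt s -> r %| s \/ s %| r.

Lemma dvd_nonzero a b : a %| b -> ~ is_zero b -> ~ is_zero a.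
Proof. by move=> [n _ ->]; exact: nonzeroMl. Qed.

(** If [a] and [b] are radical elements that divide [x] and [y] and whose powers
    are multiples of [x] and [y], then [r] divides [a b]. If [a] divides [b],
    then [r] divides [b ^+ 2], so that it divides [b]. *)
Lemma radical_elt_prime r x y : radical_elt r -> N x -> N y ->
  ~ is_zero x -> ~ is_zero y -> r %| x * y -> r %| x \/ r %| y.
Proof.
move=> rr Nx Ny x0 y0 rxy.
have [a [Na ra ax [m m0 xam]]] := radical_dvd Nx x0.
have [b [Nb rb b_y [n n0 ybn]]] := radical_dvd Ny y0.
have rab : r %| a * b.
  apply: (rr _ (m + n)%N); [exact: N_.2|by rewrite addn_gt0 m0|].
  rewrite expgMnC; apply: (dvd_trans N_ rxy); apply: (dvd_mul N_).
    by apply: (dvd_trans N_ xam); apply: dvd_exp2 => //; exact: leq_addr.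
  by apply: (dvd_trans N_ ybn); apply: dvd_exp2 => //; exact: leq_addl.
have [ab|ba] := radical_total Na Nb (dvd_nonzero ax x0) (dvd_nonzero b_y y0) ra rb.
  right; apply: (dvd_trans N_) b_y; apply: (rr _ 2) => //.
  by apply: (dvd_trans N_ rab); rewrite expg2; apply: (dvd_mul N_) => //; exact: dvd_refl.
left; apply: (dvd_trans N_) ax; apply: (rr _ 2) => //.
by apply: (dvd_trans N_ rab); rewrite expg2; apply: (dvd_mul N_) => //; exact: dvd_refl.
Qed.

(** Write [r = s u]. The prime [r] divides [s] or [u], and in the second case [s]
    would be a unit. *)
Lemma radical_elt_dvd r s : N r -> N s -> ~ is_zero r -> radical_elt r ->
  ~ s %| 1 -> s %| r -> r %| s.
Proof.
move=> Nr Ns r0 rr s1 [u Nu rE]; have su0 := r0; rewrite rE in su0.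
have rsu : r %| s * u by rewrite -rE; exact: dvd_refl.
have [//|[v Nv uE]] := radical_elt_prime rr Ns Nu (nonzeroMl su0) (nonzeroMr su0) rsu.
case: s1; exists v => //; apply: (cmulg_inj r0).
by rewrite mulg1 {1}rE uE; mulgAC_eq.
Qed.

(** All radical nonunits are associated by [radical_elt_dvd], so that one of
    them, [p], divides every nonunit, and every nonzero element divides a power
    of [p]. Dividing [p ^+ n] by [p] as long as its quotient by [x] is a nonunit
    gives the power of [p] that is associated with [x]. *)
Lemma uniformizer_exists :
  (exists x, [/\ N x, ~ is_zero x & ~ x %| 1]) -> exists p, uniformizer p.
Proof.
move=> [x0 [Nx0 nz0 nu0]].
have nonunit x r n : ~ x %| 1 -> x %| r ^+ n -> ~ r %| 1.
  move=> nux xrn r1; apply: nux; apply: (dvd_trans N_ xrn).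
  by rewrite -[X in _ %| X](expg1n _ n); exact: dvd_exp.
have [p [Np rp px0 [n0 _ x0p]]] := radical_dvd Nx0 nz0.
have nzp := dvd_nonzero px0 nz0; have nup := nonunit _ _ _ nu0 x0p.
exists p; split=> //.
have pP x : N x -> ~ is_zero x -> ~ x %| 1 -> p %| x /\ exists n, x %| p ^+ n.
  move=> Nx nzx nux; have [r [Nr rr rx [n _ xrn]]] := radical_dvd Nx nzx.
  have nzr := dvd_nonzero rx nzx; have nur := nonunit _ _ _ nux xrn.
  have [rp' pr] : r %| p /\ p %| r.
    have [rp'|pr] := radical_total Nr Np nzr nzp rr rp.
      by split=> //; exact: radical_elt_dvd.
    by split=> //; exact: radical_elt_dvd.
  split; first exact: (dvd_trans N_ pr rx).
  by exists n; apply: (dvd_trans N_ xrn); exact: dvd_exp.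
have exact_power n x : N x -> ~ is_zero x -> x %| p ^+ n ->
    exists k, x %| p ^+ k /\ p ^+ k %| x.
  elim: n x => [|n IHn] x Nx nzx xpn.
    by exists 0%N; split=> //; exists x; rewrite ?expg0 ?mul1g.
  have [h Nh hE] := xpn.
  have nzh : ~ is_zero h by have := @nonzeroX _ p n.+1 nzp; rewrite hE => /nonzeroMr.
  have [[v Nv hv]|nuh] := pselect (h %| 1).
    exists n.+1; split=> //; exists v => //.
    by rewrite hE -mulgA -hv mulg1.
  have [[k Nk hk] _] := pP h Nh nzh nuh.
  apply: IHn => //; exists k => //; apply: (cmulg_inj nzp).
  by rewrite -expgSC hE hk; mulgAC_eq.
move=> x Nx nzx; have [x1|nux] := pselect (x %| 1).
  by apply: (exact_power 0%N).
have [_ [n xpn]] := pP x Nx nzx nux; exact: exact_power xpn.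
Qed.

End DiscreteValuation.

(** * The localizations when radicals are w-invertible *)

(** A nonunit [s] of [H] is in some maximal t-ideal [Q]. If all elements of [P]
    were zeros, [P] would be contained in [Q], hence equal to [Q]. *)
Lemma tmax_has_nonzero P : tmax P -> exists2 x, P x & ~ is_zero x.
Proof.
move=> Pmax; have [g nHg] : exists g, ~ H g.
  apply: contrapT => nH; apply: HG; apply/seteqP; split=> // g _.
  by apply: contrapT => nHg; apply: nH; exists g.
have [s [Hs s0 Hsg]] := frac_in_quotient g; have [q sq] := quotient_inv s0.
have nHq : ~ H q.
  move=> Hq; apply: nHg; have -> : g = q * (s * g) by mulgAC_from g (esym sq).
  exact: in_quotientM.
have [_ ->|[F Fs [_ _ Fq]]|Q Qmax sQ] := @tmax_exists [set s].
- exact: Hs.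
- by apply: nHq; apply: Fq => f /Fs ->; rewrite cmulgC sq; exact: in_quotient1.
apply: contrapT => nP; have [_ _ Pm] := Pmax; have [Qid QH _] := Qmax.
apply: (nP); exists s => //; rewrite -(Pm Q Qid QH); first exact: sQ.
move=> x Px; apply: (tmax_zero Qmax); apply: contrapT => nzx.
by apply: nP; exists x.
Qed.

(** If [q E] is contained in [C], then, for every [P], the product of [q] and an
    element [c g] of [C C^-1] outside [P] is in [H]. *)
Lemma invertible_conductor C : invertible C -> exists E, [/\ finite_set E,
  E `<=` C & forall q, (forall c, E c -> C (q * c)) -> H q].
Proof.
move=> Cinv; have [E [E' [fE _ EC E'C EP]]] := invertible_fin Cinv.
have [[CH _ _ _] _] := Cinv.
exists E; split=> // q qE; apply: local_globalH => P Pmax.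
have [c [g [Ec E'g nPcg]]] := EP P Pmax; exists (c * g).
  by split=> //; rewrite cmulgC; apply: E'C => //; exact: EC.
have -> : c * g * q = g * (q * c) by mulgAC_eq.
by apply: E'C => //; exact: qE.
Qed.

Section InvertibleRadicals.
Hypothesis ri : radicals_invertible.

Lemma principal_radicalM x y : H x -> H y ->
  principal_radical (x * y) = principal_radical x `&` principal_radical y.
Proof.
move=> Hx Hy; have Hxy := in_quotientM Hx Hy; apply/seteqP; split=> z.
  move=> /(principal_radicalP _ Hxy)[Hz [n [n0 [h Hh zn]]]].
  split; apply/principal_radicalP => //; split=> //; exists n; split=> //.
    by exists (y * h); [exact: in_quotientM | rewrite zn mulgA].
  by exists (x * h); [exact: in_quotientM | rewrite zn; mulgAC_eq].
move=> [/(principal_radicalP _ Hx)[Hz [n [n0 [h Hh zn]]]]].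
move=> /(principal_radicalP _ Hy)[_ [m [m0 [k Hk zm]]]].
apply/principal_radicalP => //; split=> //; exists (n + m)%N.
split; first by rewrite addn_gt0 n0.
exists (h * k); first exact: in_quotientM.
by rewrite expgDC zn zm; mulgAC_eq.
Qed.

Lemma principal_radical_id x : H x -> principal_radical x x.
Proof.
move=> Hx; apply/principal_radicalP => //; split=> //; exists 1%N; split=> //.
by exists 1; rewrite ?mulg1 //; exact: in_quotient1.
Qed.

Lemma principal_radicals_comparable x y P : H x -> H y -> ~ is_zero x ->
    ~ is_zero y -> tmax P ->
  local P (principal_radical x) `<=` local P (principal_radical y) \/
  local P (principal_radical y) `<=` local P (principal_radical x).
Proof.
move=> Hx Hy x0 y0 Pmax.
have [xinv _] := ri Hx x0; have [yinv _] := ri Hy y0.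
have [xyinv _] := ri (in_quotientM Hx Hy) (is_zeroM x0 y0).
have [E [fE Exy Eq]] := invertible_conductor xyinv.
rewrite principal_radicalM // in Exy Eq.
exact: invertible_comparable Eq Pmax.
Qed.

(** The local generator [r] of the radical of [x H] is a radical element that
    divides [x] and has a power divisible by [x]. *)
Lemma radicals_uniformizer P :
  tmax P -> exists p, uniformizer (local P H) p.
Proof.
move=> Pmax; have N_ := local_overmonoid Pmax.
apply: uniformizer_exists => //.
- move=> x [s [Hs nPs] Hsx] x0; have sx0 := is_zeroM (tmax_nonzero Pmax nPs) x0.
  have [sxinv sxrad] := ri Hsx sx0.
  have [r [xr r0 rx]] := invertible_generator sxinv Pmax.
  have [[xH _ xid _] _] := sxinv; have Hr := xH _ xr.
  exists r; split; first exact: local_in.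
  + move=> z n Nz n0 rzn; apply: rx.
    apply: (local_radical Pmax xid sxrad Nz n0).
    by apply: (dvd_local Pmax xid _ rzn); exact: local_in.
  + apply: (dvd_denom Pmax Hs nPs); apply: rx; apply: local_in => //.
    exact: principal_radical_id.
  have /(principal_radicalP _ Hsx)[_ [n [n0 [h Hh rn]]]] := xr.
  exists n => //; exists (s * h); first by apply: local_in => //; exact: in_quotientM.
  by rewrite rn; mulgAC_eq.
- have half r1 r2 s1 s2 : local P H r1 -> radical_elt (local P H) r2 ->
      H s1 -> ~ P s1 -> H s2 -> H (s1 * r1) -> H (s2 * r2) ->
      local P (principal_radical (s1 * r1)) `<=` local P (principal_radical (s2 * r2)) ->
      divides (local P H) r2 r1.
    move=> Nr1 rr2 Hs1 nPs1 Hs2 H1 H2 /(_ (s1 * r1)) [].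
      by apply: local_in => //; exact: principal_radical_id.
    move=> u [Hu nPu] /(principal_radicalP _ H2)[Husr [n [n0 [h Hh usrn]]]].
    apply: (dvd_denom Pmax Hs1 nPs1); apply: (dvd_denom Pmax Hu nPu).
    apply: (rr2 _ n) => //; first exact: local_in.
    exists (s2 * h); first by apply: local_in => //; exact: in_quotientM.
    by rewrite usrn; mulgAC_eq.
  move=> r1 r2 Nr1 Nr2 r10 r20 rr1 rr2.
  have [s1 [Hs1 nPs1] H1] := Nr1; have [s2 [Hs2 nPs2] H2] := Nr2.
  have s10 := is_zeroM (tmax_nonzero Pmax nPs1) r10.
  have s20 := is_zeroM (tmax_nonzero Pmax nPs2) r20.
  have [sub|sub] := principal_radicals_comparable H1 H2 s10 s20 Pmax.
    by right; exact: (half _ _ s1 s2).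
  by left; exact: (half _ _ s2 s1).
have [x Px x0] := tmax_has_nonzero Pmax; exists x; split=> //.
  by apply: local_in => //; exact: (tmax_sub Pmax).
by move=> [n Nn] /esym; exact: (tmax_nonunit Pmax).
Qed.

Lemma radicals_almost_Dedekind : t_almost_Dedekind H.
Proof.
right=> P Pmax; have [p pu] := radicals_uniformizer Pmax.
exact: (uniformizer_DVM (local_overmonoid Pmax) pu).
Qed.

End InvertibleRadicals.
(** * Consequences of total divisibility in the localizations *)

Section LocallyTotal.
Hypothesis tot : forall P, tmax P -> dvd_total (local P H).

Lemma common_denom P E Y : tmax P -> finite_set E ->
    (forall a h, Y a -> H h -> Y (a * h)) -> (forall e, E e -> local P Y e) ->
  exists s, [/\ H s, ~ P s & forall e, E e -> Y (s * e)].
Proof.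
move=> Pmax /finite_seqP[l ->] {E} Yid; elim: l => [|e l IHl] Yl.
  by exists 1; split=> //; [exact: in_quotient1|exact: tmax1].
have [|s [Hs nPs sY]] := IHl; first by move=> x xl; apply: Yl; rewrite /= in_cons xl orbT.
have [u [Hu nPu] Yue] := Yl e (mem_head e l).
exists (u * s); split; [exact: in_quotientM|exact: tmax_prime|].
move=> x /=; rewrite in_cons => /orP[/eqP->|xl].
  by rewrite cmulgAC; exact: Yid.
by rewrite -mulgA cmulgC; apply: Yid => //; exact: sY.
Qed.

Lemma dvd_total_min P E : tmax P -> finite_set E -> E `<=` H -> E !=set0 ->
  exists2 e, E e & forall x, E x -> divides (local P H) e x.
Proof.
move=> Pmax /finite_seqP[l ->] {E}; have N_ := local_overmonoid Pmax.
elim: l => [|a l IHl] lH [x0 x0l]; first by [].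
have Na : local P H a by apply: local_in => //; apply: lH; exact: mem_head.
have lH' : [set` l] `<=` H by move=> x xl; apply: lH; rewrite /= in_cons xl orbT.
case: l => [|b l] in IHl lH lH' x0l *.
  exists a; first exact: mem_head.
  by move=> x /=; rewrite inE => /eqP->; exact: dvd_refl.
have [//||e el eP] := IHl; first by exists b; exact: mem_head.
have Ne : local P H e by apply: local_in => //; exact: lH'.
have [ae|ea] := tot Pmax Na Ne.
  exists a; first exact: mem_head.
  move=> x /=; rewrite in_cons => /orP[/eqP->|xl]; first exact: dvd_refl.
  by apply: (dvd_trans N_ ae); exact: eP.
exists e; first by rewrite /= in_cons el orbT.
by move=> x /=; rewrite in_cons => /orP[/eqP->//|xl]; exact: eP.
Qed.

Lemma local_principal P e x : tmax P -> divides (local P H) e x ->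
  local P (gen_ideal H [set e]) x.
Proof.
move=> Pmax [n [s sP Hsn] ->]; exists s => //.
by apply/gen_ideal1P; left; exists (s * n) => //; mulgAC_eq.
Qed.

(** A common denominator [s] outside [P] puts [s E] into [e H], so that [s] times
    the v-closure of [E] is contained in [e H]. *)
Lemma v_local_min E e x P : tmax P -> finite_set E -> ~ is_zero e -> E e ->
    H e -> (forall y, E y -> divides (local P H) e y) ->
    v_system H E x ->
  local P (gen_ideal H [set e]) x.
Proof.
move=> Pmax fE e0 Ee He eE /v_systemP vE; have [u eu] := quotient_inv e0.
have [_ _ gid _] := gen_ideal1_wideal He.
have [y Ey|s [Hs nPs sE]] := common_denom Pmax fE gid.
  by apply: local_principal => //; exact: eE.
exists s => //; apply/gen_ideal1P; left; exists (x * (s * u)); last first.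
  by mulgAC_from (s * x) (esym eu).
apply: vE => y /sE /gen_ideal1P[[h Hh sy]|zsy].
  suff -> : s * u * y = h by [].
  transitivity (s * y * u); first mulgAC_eq.
  by rewrite sy; mulgAC_from h eu.
have -> : s * u * y = s * y * u by mulgAC_eq.
exact/zero_in_quotient/zeroM.
Qed.

Lemma v_system_zeros E x : (forall e, E e -> is_zero e) ->
  v_system H E x -> is_zero x.
Proof.
move=> Ez /v_systemP vE; apply: contrapT => nzx; have [y xy] := quotient_inv nzx.
apply: HG; apply/seteqP; split=> // g _.
have -> : g = x * (y * g) by rewrite mulgA xy mul1g.
by apply: vE => e /Ez ze; apply: zero_in_quotient; exact: zeroMr.
Qed.

(** A nonempty finite subset [E] of [X] has a local generator in [E], so its
    v-closure is locally contained in [X H]. Conversely, if [F] is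
    inverse-trivial and every [x f] is a multiple of an element of [X], then [x]
    is in the v-closure of the finite set of these elements. *)
Lemma t_systemE X : X `<=` H -> t X = w X.
Proof.
move=> XH; apply/seteqP; split=> x.
  move=> /t_systemP[E [EX fE vE]]; apply/w_local; split.
    move/v_systemP: vE => /(_ 1); rewrite mulg1; apply=> e /EX /XH.
    by rewrite mul1g.
  move=> P Pmax; have EH : E `<=` H by move=> e /EX /XH.
  have zcase : is_zero x -> local P (gen_ideal H X) x.
    by move=> zx; apply: local_in => //; apply/(gen_idealP _ _ (@overmonoidH M)); right.
  have [E0|/nonemptyPn E0] := pselect (E !=set0); last first.
    by apply: zcase; apply: (v_system_zeros _ vE); rewrite E0.
  have [e Ee eE] := dvd_total_min Pmax fE EH E0.
  have [ze|nze] := pselect (is_zero e).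
    apply: zcase; apply: (v_system_zeros _ vE) => y /eE[n _ ->].
    exact: zeroM.
  apply: localS (v_local_min Pmax fE nze Ee (EH _ Ee) eE vE) => y.
  move=> /gen_ideal1P yE; apply/(gen_idealP _ _ (@overmonoidH M)).
  case: yE => [[h Hh ->]|]; [left; exists e, h|by right].
  by split=> //; exact: EX.
move=> /w_systemP[Hx [F [FH fF Fq] xF]]; apply/t_systemP.
have /choice[S SP] f : exists S, F f ->
    [/\ S `<=` X, finite_set S & forall q, (forall e, S e -> H (q * e)) -> H (q * (x * f))].
  have [Ff|nFf] := pselect (F f); last by exists set0.
  have /(gen_idealP _ _ (@overmonoidH M))[[a [h [Xa Hh ->]]]|zxf] := xF f Ff.
    exists [set a]; split=> // [_ ->//|q qa]; rewrite mulgA.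
    by apply: in_quotientM => //; exact: qa.
  by exists set0; split=> // q _; exact/zero_in_quotient/zeroMr.
exists (\bigcup_(f in F) S f); split.
- by move=> y [f Ff Sy]; have [SX _ _] := SP f Ff; exact: SX.
- by apply: bigcup_finite => // f Ff; have [] := SP f Ff.
apply/v_systemP => q qS; apply: Fq => f Ff; have [_ _ Sq] := SP f Ff.
have -> : x * q * f = q * (x * f) by mulgAC_eq.
by apply: Sq => e Se; apply: qS; exists f.
Qed.

Lemma r_ideal_tw X : r_ideal H t X <-> r_ideal H w X.
Proof. by split=> -[XH tX]; split=> //; rewrite -?t_systemE // t_systemE. Qed.

Lemma radical_r_product_tw X :
  radical_r_product H t X <-> radical_r_product H w X.
Proof.
have tw n (I : 'I_n.+1 -> set G) : (forall i, wideal (I i)) ->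
    r_product t I = r_product w I.
  by move=> Iw; rewrite /r_product t_systemE //; exact: bigprodsetH.
split=> -[n [I [Irad ->]]]; exists n, I; split.
- by move=> i; have [/r_ideal_tw] := Irad i; split.
- apply: tw => i; have [/r_ideal_tw + _] := Irad i.
  by move=> /widealP.
- by move=> i; have [/r_ideal_tw] := Irad i; split.
- symmetry; apply: tw => i; have [+ _] := Irad i.
  by move=> /widealP.
Qed.

Lemma SP_monoid_tw : SP_monoid H t <-> SP_monoid H w.
Proof.
by split=> sp X /r_ideal_tw /sp /radical_r_product_tw.
Qed.

(** Locally [x = e (g x) / (e g)] with [e] in [E]. *)
Lemma invertible_r_fin_gen I : invertible I -> r_fin_gen H w I.
Proof.
move=> Iinv; have [Iw _] := Iinv; have [IH _ Iid _] := Iw.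
have [E [E' [fE _ EI E'I EP]]] := invertible_fin Iinv.
split; first exact/widealP.
exists E; split=> //; apply/seteqP; split; last exact: w_min.
move=> x Ix; apply/w_local; split=> [|P Pmax]; first exact: IH.
have [e [g [Ee E'g nPeg]]] := EP P Pmax; exists (e * g).
  by split=> //; rewrite cmulgC; apply: E'I => //; exact: EI.
apply/(gen_idealP _ _ (@overmonoidH M)); left; exists e, (g * x).
by split=> //; [exact: E'I | rewrite mulgA].
Qed.

Lemma r_fin_gen_zeros : r_fin_gen H w (zeros H).
Proof.
have zE : zeros H = w set0.
  apply/seteqP; split=> x; rewrite (zerosE (@overmonoidH M)) => /=.
    by move=> zx; have [_ z0 _ _] := w_wideal set0; exact: z0.
  move=> /w_systemP[Hx [F Ftriv xF]]; apply: contrapT => nzx.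
  have [P Pmax _] : exists2 P, tmax P & set0 `<=` P.
    apply: tmax_exists => // -[E E0 [_ _ Eq]].
    apply: HG; apply/seteqP; split=> // q _.
    by apply: Eq => f /E0.
  have [f Ff nPf] := tmax_inverse_trivial Pmax Ftriv.
  have /(gen_idealP _ _ (@overmonoidH M))[[a [h []]]//|] := xF f Ff.
  exact: is_zeroM nzx (tmax_nonzero Pmax nPf).
split; first by rewrite zE; apply/widealP; exact: w_wideal.
by exists set0.
Qed.

(** Where [x] divides [y], the ideal [x H `&` y H] is locally generated by [y],
    whose inverse in [G] is in the inverse of this ideal. *)
Lemma total_finite_conductor : finite_conductor_monoid H w.
Proof.
move=> x y Hx Hy; set L := _ `&` _.
have LP z : L z <-> (exists2 h, H h & z = x * h) /\ exists2 h, H h & z = y * h.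
  split=> [[[_ -> [h Hh <-]] [_ -> [k Hk E]]]|[[h Hh zx] [k Hk zy]]].
    by split; [exists h | exists k].
  by split; [exists x => //; exists h | exists y => //; exists k].
have LidH z h : L z -> H h -> L (z * h).
  move=> /LP[[m Hm zm] [n Hn zn]] Hh; apply/LP; split.
    by exists (m * h); [exact: in_quotientM | rewrite zm mulgA].
  by exists (n * h); [exact: in_quotientM | rewrite zn mulgA].
have Lzero z : is_zero z -> L z.
  move=> zz; have Hz := zero_in_quotient zz.
  by apply/LP; split; exists z => //; rewrite cmulgC zz.
have [zx|x0] := pselect (is_zero x \/ is_zero y).
  have -> : L = zeros H.
    rewrite (zerosE (@overmonoidH M)); apply/seteqP; split=> [z|z /Lzero//].
    by move=> /LP[[h _ zh] [k _ zk]]; case: zx; [rewrite zh|rewrite zk]; exact: zeroM.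
  exact: r_fin_gen_zeros.
have {x0}[x0 y0] : ~ is_zero x /\ ~ is_zero y.
  by split=> z; apply: x0; [left|right].
apply: invertible_r_fin_gen.
have half a b P : H a -> H b -> ~ is_zero b -> tmax P -> divides (local P H) a b ->
    (forall z, L z <-> (exists2 h, H h & z = a * h) /\ exists2 h, H h & z = b * h) ->
    exists i g, [/\ L i, (forall y, L y -> H (g * y)) & ~ P (i * g)].
  move=> Ha Hb b0 Pmax [n [s [Hs nPs] Hsn] bE] LE; have [g bg] := quotient_inv b0.
  exists (s * b), g; split.
  - apply/LE; split; last by exists s => //; exact: cmulgC.
    by exists (s * n) => //; rewrite bE; mulgAC_eq.
  - move=> z /LE[_ [h Hh ->]]; suff -> : g * (b * h) = h by [].
    by mulgAC_from h bg.
  - by have -> : s * b * g = s by mulgAC_from s bg.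
split=> [|P Pmax].
  split=> // [z /LP[[h Hh ->] _]|z locz]; first exact: in_quotientM.
  have [_ x0' _ xloc] := gen_ideal1_wideal Hx.
  have [_ y0' _ yloc] := gen_ideal1_wideal Hy.
  have : gen_ideal H [set x] z.
    apply: xloc => P Pmax; apply: localS (locz P Pmax) => a /LP[[h Hh ->] _].
    by apply/gen_ideal1P; left; exists h.
  have : gen_ideal H [set y] z.
    apply: yloc => P Pmax; apply: localS (locz P Pmax) => a /LP[_ [h Hh ->]].
    by apply/gen_ideal1P; left; exists h.
  move=> /gen_ideal1P[ya|/Lzero//] /gen_ideal1P[xa|/Lzero//].
  by apply/LP.
have N_ := local_overmonoid Pmax.
have [Nx Ny] := (local_in Pmax Hx, local_in Pmax Hy).
have [xy|yx] := tot Pmax Nx Ny.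
  exact: (half x y).
by apply: (half y x) => // z; split=> [/LP[]|[]] zx zy; [split | apply/LP; split].
Qed.

End LocallyTotal.

(** * Factorization of w-ideals *)

Lemma r_product1 (r : set G -> set G) X :
  r_ideal H r X -> X = r_product r (fun=> X : set G) (n := 1).
Proof.
move=> [_ rX]; rewrite /r_product big_ord_recl big_ord0.
suff -> : prodset X [set 1] = X by [].
apply/seteqP; split=> [_ [x Xx [_ -> <-]]|x Xx]; first by rewrite mulg1.
by exists x => //; exists 1; rewrite ?mulg1.
Qed.

Lemma comparable_radical_r_product1 (r : set G -> set G) X :
  radical_r_ideal H r X -> comparable_radical_r_product H r X.
Proof.
move=> rX; exists 0%N, (fun=> X); split=> //; first by left.
by apply: r_product1; case: rX.
Qed.

Lemma comparable_productW (r : set G -> set G) X :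
  comparable_radical_r_product H r X -> radical_r_product H r X.
Proof. by move=> [n [I [Irad _ XE]]]; exists n, I. Qed.

Lemma big_if_expg (p : G) n m : (n <= m)%N ->
  \big[mul/1]_(i < m) (if (i < n)%N then p else 1) = p ^+ n.
Proof.
by move=> nm; rewrite -big_mkcond -(big_ord_widen _ (fun=> p)) // big_const_expg.
Qed.

Lemma dvd_big N n (f g : 'I_n -> G) : overmonoid N ->
    (forall i, divides N (f i) (g i)) ->
  divides N (\big[mul/1]_(i < n) f i) (\big[mul/1]_(i < n) g i).
Proof.
move=> N_; elim: n f g => [|n IHn] f g fg.
  by rewrite !big_ord0; exact: dvd_refl.
by rewrite !big_ord_recl; apply: dvd_mul => //; exact: IHn.
Qed.

Lemma uniformizer_exp_le N (p : G) m n : uniformizer N p ->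
  divides N (p ^+ m) (p ^+ n) -> overmonoid N -> (m <= n)%N.
Proof.
move=> [Np p0 p1 _] [k Nk E] N_; rewrite leqNgt; apply/negP => nm; apply: p1.
exists (p ^+ (m - n.+1) * k); first by apply: N_.2 => //; exact: overmonoidX.
apply: (cmulg_inj (@nonzeroX _ p n p0)).
by rewrite mulg1 {1}E -(subnKC nm) expgDC expgSC subnKC //; mulgAC_eq.
Qed.

Lemma tmaxX P x n : tmax P -> H x -> ~ P x -> ~ P (x ^+ n).
Proof.
move=> Pmax Hx nPx; elim: n => [|n IHn]; first exact: tmax1.
by rewrite expgSC; apply: tmax_prime => //; exact: in_quotientX.
Qed.

Lemma tmax_principal_radical P x : tmax P -> H x -> P x ->
  principal_radical x `<=` P.
Proof.
move=> Pmax Hx Px y /(principal_radicalP _ Hx)[Hy [n [_ [h Hh yn]]]].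
apply: contrapT => /(@tmaxX _ _ n Pmax Hy); apply.
by rewrite yn; exact: tmaxM.
Qed.

Section Factorization.
Hypothesis ri : radicals_invertible.
Variable pi : set G -> G.
Hypothesis piP : forall P, tmax P -> uniformizer (local P H) (pi P).

(** The inequality [v x >= k] for the valuation [v] of [H_P]. *)
Definition val_ge P k x := divides (local P H) (pi P ^+ k) x.

Lemma val_ge_le P k l x : tmax P -> (k <= l)%N -> val_ge P l x -> val_ge P k x.
Proof.
move=> Pmax kl; apply: dvd_trans; first exact: local_overmonoid.
by apply: dvd_exp2; [exact: local_overmonoid | case: (piP Pmax) |].
Qed.

Lemma val_ge1 P x : tmax P -> H x -> val_ge P 1 x <-> P x.
Proof.
move=> Pmax Hx; have [Np p0 p1 px] := piP Pmax.
have N_ := local_overmonoid Pmax; rewrite /val_ge expg1; split=> [pdx|Px].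
  apply: contrapT => nPx; apply: p1; apply: (dvd_trans N_ pdx).
  by have [u Nu xu] := local_inv Pmax Hx nPx; exists u.
have [zx|nzx] := pselect (is_zero x); first exact: dvd_zero.
have [[|k] [xk kx]] := px x (local_in Pmax Hx) nzx.
  by case: xk => u Nu /esym xu; case: (tmax_nonunit Pmax Px Nu xu).
apply: (dvd_trans N_) kx; rewrite expgSC; exists (pi P ^+ k) => //.
exact: overmonoidX.
Qed.

Lemma val_ge_tmax P k x : tmax P -> H x -> val_ge P k.+1 x -> P x.
Proof. by move=> Pmax Hx /(val_ge_le Pmax (ltn0Sn k)) /(val_ge1 Pmax Hx). Qed.

Lemma pi_principal_radical P x : tmax P -> H x -> ~ is_zero x -> P x ->
  local P (principal_radical x) (pi P).
Proof.
move=> Pmax Hx x0 Px; have [[[_ _ xid _] _] xrad] := ri Hx x0.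
have [Np p0 p1 px] := piP Pmax.
have [[|k] [xk _]] := px x (local_in Pmax Hx) x0.
  by case: xk => u Nu /esym xu; case: (tmax_nonunit Pmax Px Nu xu).
apply: (local_radical Pmax xid xrad Np (ltn0Sn k)).
apply: (dvd_local Pmax xid _ xk); apply: local_in => //.
exact: principal_radical_id.
Qed.

(** Let [g] be an element of the inverse of the radical of [x H], such that
    [e g] is outside [P] for an [e] in this radical. Multiplication by [g]
    decreases by one the value of [x] at [P], and by at most one its value at
    any other maximal t-ideal; so induction applies to [g x]. *)
Lemma val_separation k x P : H x -> ~ is_zero x -> tmax P ->
    ~ val_ge P k.+1 x ->
  exists y, [/\ H y, ~ P y & forall Q, tmax Q -> val_ge Q k.+1 x -> Q y].
Proof.
elim: k x => [|k IHk] x Hx x0 Pmax nx.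
  exists x; split=> // [Px|Q Qmax]; last exact: val_ge_tmax.
  by apply: nx; apply/val_ge1.
have [Px|nPx] := pselect (P x); last first.
  by exists x; split=> // Q Qmax; exact: val_ge_tmax.
have [[_ xinv] _] := ri Hx x0; have [e [g [xe xg nPeg]]] := xinv P Pmax.
have Hgx : H (g * x) by apply: xg; exact: principal_radical_id.
have He : H e by case: xe.
have Heg : H (e * g) by rewrite cmulgC; exact: xg.
have eg0 := tmax_nonzero Pmax nPeg.
have [||//||y [Hy nPy yQ]] := IHk (g * x).
- exact: Hgx.
- by apply: is_zeroM => //; exact: nonzeroMr eg0.
- move=> gx; apply: nx; apply: (dvd_denom Pmax Heg nPeg).
  have -> : e * g * x = e * (g * x) by mulgAC_eq.
  rewrite expgSC; apply: dvd_mul => //; first exact: local_overmonoid.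
  rewrite -[pi P]expg1; apply/(val_ge1 Pmax He).
  exact: (tmax_principal_radical Pmax Hx Px).
exists y; split=> // Q Qmax vx; apply: yQ => //.
have Qx := val_ge_tmax Qmax Hx vx.
have [s [Hs nQs] xsp] := pi_principal_radical Qmax Hx x0 Qx.
have [n Nn xE] := vx; apply: (dvd_denom Qmax Hs nQs).
exists (g * (s * pi Q) * n).
  have N_ := local_overmonoid Qmax.
  by apply: N_.2 => //; apply: local_in => //; exact: xg.
by rewrite {1}xE expgSC; mulgAC_eq.
Qed.

(** A fixed power of the finitely generated radical of [x H] is contained in
    [x H], which bounds the values of [x]. *)
Lemma val_bounded x : H x -> ~ is_zero x ->
  exists n, forall P, tmax P -> divides (local P H) x (pi P ^+ n).
Proof.
move=> Hx x0; have [xinv xrad] := ri Hx x0.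
have [E [E' [/finite_seqP[l ->] _ Ex E'x EP]]] := invertible_fin xinv.
have [m lm] : exists m, forall e, e \in l -> exists2 h, H h & e ^+ m = x * h.
  elim: l Ex {EP} => [|e l IHl] lx; first by exists 0%N.
  have [m lm] := IHl (fun y yl => lx y (mem_behead (s := e :: l) yl)).
  have /(principal_radicalP _ Hx)[He [n [_ [h Hh en]]]] := lx e (mem_head e l).
  exists (n + m)%N => y; rewrite in_cons => /orP[/eqP->|yl].
    exists (h * e ^+ m); first by apply: in_quotientM => //; exact: in_quotientX.
    by rewrite expgDC en mulgA.
  have [k Hk yk] := lm y yl.
  have [Hy _] := lx y (mem_behead (s := e :: l) yl).
  exists (k * y ^+ n); first by apply: in_quotientM => //; exact: in_quotientX.
  by rewrite expgDC yk; mulgAC_eq.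
exists m => P Pmax; have N_ := local_overmonoid Pmax.
have [Np _ _ _] := piP Pmax.
have [Px|nPx] := pselect (P x); last first.
  have [u Nu xu] := local_inv Pmax Hx nPx.
  exists (u * pi P ^+ m); last by rewrite mulgA xu mul1g.
  by apply: N_.2 => //; exact: overmonoidX.
have [e [g [el E'g nPeg]]] := EP P Pmax; have [h Hh em] := lm e el.
have Heg : H (e * g) by rewrite cmulgC; apply: E'x => //; exact: Ex.
have [s [Hs nPs] xsp] := pi_principal_radical Pmax Hx x0 Px.
have ep : divides (local P H) e (pi P).
  apply: (dvd_denom Pmax Heg nPeg); apply: (dvd_denom Pmax Hs nPs).
  exists (g * (s * pi P)); last mulgAC_eq.
  by apply: local_in => //; exact: E'x.
apply: (dvd_trans N_) (dvd_exp N_ m ep); exists h => //.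
exact: local_in.
Qed.

Lemma min_value P X x0 : tmax P -> X `<=` H -> X x0 -> ~ is_zero x0 ->
  exists n y, [/\ X y, ~ is_zero y, divides (local P H) y (pi P ^+ n),
    val_ge P n y & forall x, X x -> val_ge P n x].
Proof.
move=> Pmax XH Xx0 nz0; have [Np p0 p1 px] := piP Pmax.
have N_ := local_overmonoid Pmax.
pose vals k := `[< exists y,
  [/\ X y, divides (local P H) y (pi P ^+ k) & val_ge P k y] >].
have : exists k, vals k.
  have [k [xk kx]] := px x0 (local_in Pmax (XH _ Xx0)) nz0.
  by exists k; apply/asboolP; exists x0.
move=> /ex_minnP[n /asboolP[y [Xy yn ny]] nmin]; exists n, y; split=> //.
  by case: yn => k _ E zy; apply: (@nonzeroX _ (pi P) n p0); rewrite E; exact: zeroM.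
move=> x Xx; have [zx|nzx] := pselect (is_zero x); first exact: dvd_zero.
have [k [xk kx]] := px x (local_in Pmax (XH _ Xx)) nzx.
by apply: (val_ge_le Pmax _ kx); apply: nmin; apply/asboolP; exists x.
Qed.

(** For a nonzero w-ideal [X], the value of [X] at [P] is the number of [k] such
    that [level X k] is contained in [P]; this makes [X] the product of its
    levels. *)
Definition level X k := [set x | H x /\
  forall P, tmax P -> (forall y, X y -> val_ge P k.+1 y) -> P x].

Lemma level_wideal X k : wideal (level X k).
Proof.
split=> [x []//|z zz|a h [Ha aP] Hh|g locg].
- split=> [|P Pmax _]; first exact: zero_in_quotient.
  exact: tmax_zero.
- split=> [|P Pmax XP]; first exact: in_quotientM.
  by apply: tmaxM => //; exact: aP.
have Hg : H g by apply: local_globalH => P Pmax; apply: localS (locg P Pmax) => x [].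
split=> // P Pmax XP; have [s [Hs nPs] [_ /(_ P Pmax XP) Psg]] := locg P Pmax.
by apply: contrapT => nPg; exact: (tmax_prime Pmax Hs Hg nPs nPg).
Qed.

Lemma level_radical X k : radical_closed (level X k).
Proof.
move=> x n Hx _ [_ xnP]; split=> // P Pmax XP.
by apply: contrapT => /(@tmaxX _ _ n Pmax Hx); apply; exact: xnP.
Qed.

Lemma level_sub X k l : (k <= l)%N -> level X k `<=` level X l.
Proof.
move=> kl x [Hx xP]; split=> // P Pmax XP; apply: xP => // y Xy.
by apply: (val_ge_le Pmax _ (XP y Xy)).
Qed.

(** If the minimum [n] of the values on [X] at [P] is attained at [y], then
    [level X k] is generated at [P] by [pi P] for [k < n], because it contains
    the radical of [y H], and by [1] for [k >= n], by separation. *)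
Lemma level_value X P n y k : tmax P -> X `<=` H -> X y -> ~ is_zero y ->
    divides (local P H) y (pi P ^+ n) -> val_ge P n y ->
  exists2 f, level X k f &
    divides (local P H) f (if (k < n)%N then pi P else 1).
Proof.
move=> Pmax XH Xy y0 yn ny; have Hy := XH _ Xy; have N_ := local_overmonoid Pmax.
case: ltnP => kn.
  have Py : P y by move: kn ny; case: (n) => // m _; exact: val_ge_tmax.
  have [s [Hs nPs] ysp] := pi_principal_radical Pmax Hy y0 Py.
  exists (s * pi P).
    split=> [|Q Qmax XQ]; first by case: ysp.
    apply: (tmax_principal_radical Qmax Hy) ysp.
    exact: val_ge_tmax (XQ y Xy).
  have [u Nu su] := local_inv Pmax Hs nPs; exists u => //.
  by mulgAC_from (pi P) (esym su).
have [|f [Hf nPf fQ]] := @val_separation k y P Hy y0 Pmax.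
  move=> vy; have := uniformizer_exp_le (piP Pmax) (dvd_trans N_ vy yn) N_.
  by rewrite ltnNge kn.
exists f; first by split=> // Q Qmax XQ; apply: fQ => //; exact: XQ.
by have [u Nu fu] := local_inv Pmax Hf nPf; exists u.
Qed.

(** Both sides are w-ideals, so it suffices to compare them at each [P]. If the
    minimum [n] of the values on [X] is attained at [y], then [X] is generated
    by [y] at [P], and the product of the levels by [pi P ^+ n]. *)
Lemma comparable_factorization X : wideal X ->
  comparable_radical_r_product H w X.
Proof.
move=> Xw; have [XH X0 Xid Xloc] := Xw.
have [[x0 [Xx0 nz0]]|Xz] := pselect (exists x, X x /\ ~ is_zero x); last first.
  apply: comparable_radical_r_product1; apply/radical_r_idealP; split=> //.
  move=> x n Hx _ Xxn; apply: X0; apply: contrapT => /(@nonzeroX _ _ n) nzxn.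
  by apply: Xz; exists (x ^+ n).
have [m mP] := val_bounded (XH _ Xx0) nz0.
exists m, (fun i : 'I_m.+1 => level X i); split.
- move=> i; apply/radical_r_idealP; split; first exact: level_wideal.
  exact: level_radical.
- move=> i j; have [ij|/ltnW ji] := leqP i j; [left|right]; exact: level_sub.
have nm P n : tmax P -> (forall x, X x -> val_ge P n x) -> (n <= m.+1)%N.
  move=> Pmax Xn; have N_ := local_overmonoid Pmax; apply: leqW.
  apply: (uniformizer_exp_le (piP Pmax) _ N_).
  exact: (dvd_trans N_ (Xn _ Xx0) (mP P Pmax)).
apply/seteqP; split=> [x Xx|].
  apply/w_local; split=> [|P Pmax]; first exact: XH.
  have N_ := local_overmonoid Pmax.
  have [n [y [Xy y0 yn ny Xn]]] := min_value Pmax XH Xx0 nz0.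
  have /choice[f fP] (i : 'I_m.+1) : exists f, level X i f /\
      divides (local P H) f (if (i < n)%N then pi P else 1).
    by have [f ? ?] := level_value i Pmax XH Xy y0 yn ny; exists f.
  have /(dvd_trans N_ (b := pi P ^+ n)) : divides (local P H) (\big[mul/1]_(i < m.+1) f i) (pi P ^+ n).
    by rewrite -(big_if_expg _ (nm P n Pmax Xn)); apply: dvd_big => // i; case: (fP i).
  move=> /(_ _ (Xn x Xx))[k [s [Hs nPs] Hsk] xE]; exists s => //.
  apply/(gen_idealP _ _ (@overmonoidH M)); left.
  exists (\big[mul/1]_(i < m.+1) f i), (s * k); split=> //.
    by apply/bigprodsetP; exists f => // i; case: (fP i).
  by rewrite xE; mulgAC_eq.
apply: w_min => // z /bigprodsetP[f Kf ->]; apply: Xloc => P Pmax.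
have N_ := local_overmonoid Pmax.
have [n [y [Xy y0 yn ny Xn]]] := min_value Pmax XH Xx0 nz0.
apply: (dvd_local Pmax Xid (local_in Pmax Xy)); apply: (dvd_trans N_ yn).
rewrite -(big_if_expg _ (nm P n Pmax Xn)); apply: dvd_big => // i.
have [Hf fP] := Kf i; case: ltnP => lin; last first.
  by exists (f i); rewrite ?mul1g //; exact: local_in.
rewrite -[pi P]expg1; apply/(val_ge1 Pmax Hf); apply: fP => // x Xx.
exact: (val_ge_le Pmax lin (Xn x Xx)).
Qed.

End Factorization.

(** * The equivalences *)

Lemma radicals_comparable_products : radicals_invertible ->
  forall X, r_ideal H w X -> comparable_radical_r_product H w X.
Proof.
move=> ri X /widealP.
have /choice[pi piP] P : exists p, tmax P -> uniformizer (local P H) p.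
  have [Pmax|nP] := pselect (tmax P); last by exists 1.
  by have [p pP] := radicals_uniformizer ri Pmax; exists p.
exact: (comparable_factorization ri piP).
Qed.

Lemma radicals_dvd_total : radicals_invertible ->
  forall P, tmax P -> dvd_total (local P H).
Proof.
move=> ri P Pmax; have [p pP] := radicals_uniformizer ri Pmax.
exact: (uniformizer_total (local_overmonoid Pmax) pP).
Qed.

Lemma comparable_products_SP :
    (forall X, r_ideal H w X -> comparable_radical_r_product H w X) ->
  SP_monoid H w.
Proof. by move=> cp X /cp; exact: comparable_productW. Qed.

Lemma principalP X : principal H X ->
  (exists2 x, H x & X = gen_ideal H [set x]) \/ X = zeros H.
Proof.
move=> [A [AH A1 ->]].
have [[x Ax]|/nonemptyPn ->] := pselect (A !=set0).
  left; exists x; first exact: AH.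
  by congr gen_ideal; apply/seteqP; split=> [y Ay|_ ->//]; exact: A1.
right; apply/seteqP; split=> y; last by right.
by move=> [[x []]|].
Qed.

Lemma principal1 x : H x -> principal H (gen_ideal H [set x]).
Proof. by move=> Hx; exists [set x]; split=> // [_ ->//|_ _ -> ->]. Qed.

Lemma principal_wideal X : principal H X -> wideal X.
Proof.
move=> /principalP[[x Hx ->]|->]; first exact: gen_ideal1_wideal.
by have [/widealP] := r_fin_gen_zeros.
Qed.

Lemma principal_radical_closed x : H x -> radical_closed (principal_radical x).
Proof.
move=> Hx y n Hy n0 /(principal_radicalP _ Hx)[_ [m [m0 [h Hh ynm]]]].
apply/principal_radicalP => //; split=> //; exists (n * m)%N.
by rewrite muln_gt0 n0 m0; split=> //; exists h => //; rewrite expgnA.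
Qed.

Lemma radicals_invertibleE : radicals_invertible <->
  forall X, principal H X -> nontrivial H X -> r_invertible H w (radical H X).
Proof.
split=> [ri X /principalP[[x Hx ->]|->] [_ nX]|ri x Hx x0]; last first.
- split; last exact: principal_radical_closed.
  apply/invertibleP; apply: ri; first exact: principal1.
  split=> [z zz|]; first by right.
  move=> /(_ x); rewrite (zerosE (@overmonoidH M)) => zx; apply/x0/zx.
  apply/gen_ideal1P; left; exists 1; rewrite ?mulg1 //; exact: in_quotient1.
- by case: nX.
have x0 : ~ is_zero x.
  move=> zx; apply: nX => y /gen_ideal1P; rewrite (zerosE (@overmonoidH M)).
  by case=> // -[h _ ->]; exact: zeroM.
by apply/invertibleP; have [+ _] := ri x Hx x0.
Qed.

Lemma equivalences_nongroup :
  [<-> t_almost_Dedekind H /\ SP_monoid H t;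
       SP_monoid H w;
       finite_conductor_monoid H w /\
         (forall X, principal H X -> radical_r_product H w X);
       forall X, r_ideal H w X -> comparable_radical_r_product H w X;
       forall X, principal H X -> nontrivial H X ->
         r_invertible H w (radical H X)].
Proof.
have SP_ri : SP_monoid H w -> radicals_invertible.
  move=> sp; apply: comparable_radicals_invertible.
    exact: SP_locally_comparable.
  exact: SP_radical_factorial.
tfae.
- move=> [[HQ|aD] sp]; first by case: HG; rewrite HQ quotientE //; exact: overmonoidH.
  apply/SP_monoid_tw => // P Pmax.
  by apply: (DVM_total (local_overmonoid Pmax)); exact: aD.
- move=> sp; split; last by move=> X /principal_wideal Xw; apply/sp/widealP.
  by apply: total_finite_conductor; exact/radicals_dvd_total/SP_ri.
- move=> [fc pf]; have rf : radical_factorial by move=> x Hx; exact/pf/principal1.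
  apply/radicals_comparable_products/comparable_radicals_invertible => //.
  exact: finite_conductor_locally_comparable.
- by move=> /comparable_products_SP /SP_ri /radicals_invertibleE.
- move=> /radicals_invertibleE ri; split; first exact: radicals_almost_Dedekind.
  apply/SP_monoid_tw; first exact: radicals_dvd_total.
  exact/comparable_products_SP/radicals_comparable_products.
Qed.

End MaximalIdeals.

(** * The case of a group, with or without zero *)

Section GroupCase.
Variable M : cancelComMonoidType.
Local Notation G := (quotient_monoid M).
Local Notation H := (in_quotient M).
Local Notation t := (t_system H).
Local Notation w := (w_system H).
Hypothesis HG : H = setT.
Implicit Types (x y z g : G) (X A : set G).

Let HH : overmonoid H. Proof. exact: overmonoidH. Qed.

Let inH x : H x. Proof. by rewrite HG. Qed.

Let zerosP x : zeros H x <-> is_zero x. Proof. by rewrite (zerosE HH). Qed.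

Lemma group_t X :
  t X = if `[< X `<=` zeros H >] then zeros H else H.
Proof. by rewrite /t_system (quotientE HH); case: asboolP. Qed.

Lemma group_t_zeros : t (zeros H) = zeros H.
Proof. by rewrite group_t; case: asboolP => // -[]. Qed.

Lemma group_t_full X x : X x -> ~ is_zero x -> t X = H.
Proof.
by move=> Xx x0; rewrite group_t; case: asboolP => // /(_ x Xx) /zerosP.
Qed.

Lemma group_w : w = t.
Proof.
apply/funext => X; apply/seteqP; split=> x.
  move=> [Hx [F [FH xF tF]]]; rewrite group_t; case: asboolP => // Xz.
  have [f Ff f0] : exists2 f, F f & ~ is_zero f.
    apply: contrapT => nF; have := @is_zero1 G; apply; apply/zerosP.
    suff <- : t F = zeros H by rewrite tF.
    rewrite group_t; case: asboolP => // -[] f Ff; apply/zerosP.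
    by apply: contrapT => f0; apply: nF; exists f.
  apply/zerosP; apply: contrapT => x0.
  have : gen_ideal H X (x * f) by apply: xF; exists x => //; exists f.
  move=> /(gen_idealP _ _ HH)[[a [h [/Xz/zerosP za _ E]]]|]; last exact: is_zeroM.
  by apply: (is_zeroM x0 f0); rewrite E; exact: zeroM.
move=> tx; split; first exact: inH.
exists [set 1]; split=> [f _||]; first exact: inH.
  2: exact: (group_t_full erefl (@is_zero1 G)).
move=> _ [_ -> [_ -> <-]]; apply/(gen_idealP _ _ HH); rewrite mulg1.
move: tx; rewrite group_t; case: asboolP => [_ /zerosP zx|nX _]; first by right.
left; have [y Xy y0] : exists2 y, X y & ~ is_zero y.
  apply: contrapT => nXy; apply: nX => y Xy; apply/zerosP.
  by apply: contrapT => y0; apply: nXy; exists y.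
have [z yz] := quotient_inv y0; exists y, (z * x).
by rewrite mulgA yz mul1g; split.
Qed.

Lemma group_ideal X : (forall z, is_zero z -> X z) ->
  (forall x g, X x -> X (x * g)) -> X = zeros H \/ X = H.
Proof.
move=> X0 Xid; have [[x [Xx x0]]|Xz] := pselect (exists x, X x /\ ~ is_zero x).
  right; rewrite HG; apply/seteqP; split=> // g _.
  have [y xy] := quotient_inv x0.
  have -> : g = x * (y * g) by rewrite mulgA xy mul1g.
  exact: Xid.
left; apply/seteqP; split=> x; last by move/zerosP; exact: X0.
by move=> Xx; apply/zerosP; apply: contrapT => x0; apply: Xz; exists x.
Qed.

Lemma group_radical_r_ideal X : X = zeros H \/ X = H ->
  radical_r_ideal H t X.
Proof.
move=> XE; split.
  split=> [x _|]; first exact: inH.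
  case: XE => ->; first exact: group_t_zeros.
  exact: (group_t_full (inH 1) (@is_zero1 G)).
apply/seteqP; split=> x; last by move=> Xx; split; [exact: inH | exists 1%N].
case: XE => -> [Hx [n _]]; last by [].
by move=> /zerosP zxn; apply/zerosP; apply: contrapT => /(@nonzeroX _ _ n).
Qed.

Lemma group_r_ideal X : r_ideal H t X -> X = zeros H \/ X = H.
Proof. by move=> [_ <-]; rewrite group_t; case: asboolP; [left | right]. Qed.

Lemma group_gen_ideal X : gen_ideal H X = zeros H \/ gen_ideal H X = H.
Proof.
apply: group_ideal => [z zz|x g]; first by apply/(gen_idealP _ _ HH); right.
move=> /(gen_idealP _ _ HH)[[a [h [Xa _ ->]]]|zx]; apply/(gen_idealP _ _ HH).
  by left; exists a, (h * g); rewrite mulgA; split.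
by right; exact: zeroM.
Qed.

Lemma group_product X : X = zeros H \/ X = H ->
  comparable_radical_r_product H t X.
Proof. by move/group_radical_r_ideal; exact: comparable_radical_r_product1. Qed.

Lemma group_finite_conductor : finite_conductor_monoid H t.
Proof.
move=> x y _ _; set L := _ `&` _.
have LE : L = zeros H \/ L = H.
  have inxH a b z : a * b = z -> prodset [set a] H z.
    by move=> <-; exists a => //; exists b.
  apply: group_ideal => [z zz|z g [[_ -> [h _ hz]] [_ -> [k _ kz]]]].
    by split; apply: (inxH _ z); rewrite cmulgC zz.
  split; [apply: (inxH _ (h * g))|apply: (inxH _ (k * g))].
    by rewrite mulgA hz.
  by rewrite mulgA kz.
have [Lid _] := group_radical_r_ideal LE; split=> //.
case: LE => ->.
  exists set0; split=> //; rewrite group_t; case: asboolP => // -[] //.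
exists [set 1]; split=> //.
by symmetry; exact: (group_t_full erefl (@is_zero1 G)).
Qed.

Lemma equivalences_group :
  [<-> t_almost_Dedekind H /\ SP_monoid H t;
       SP_monoid H w;
       finite_conductor_monoid H w /\
         (forall X, principal H X -> radical_r_product H w X);
       forall X, r_ideal H w X -> comparable_radical_r_product H w X;
       forall X, principal H X -> nontrivial H X ->
         r_invertible H w (radical H X)].
Proof.
rewrite group_w.
have cp X : r_ideal H t X -> comparable_radical_r_product H t X.
  by move=> /group_r_ideal; exact: group_product.
have sp : SP_monoid H t by move=> X /cp; exact: comparable_productW.
tfae=> // _.
- split; first exact: group_finite_conductor.
  move=> X [A [_ _ ->]]; apply/comparable_productW/group_product.
  exact: group_gen_ideal.
- move=> X [A [_ _ ->]] [_ nX]; case: (group_gen_ideal A) => XE.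
    by case: nX; rewrite XE.
  have [Hid HrH] := group_radical_r_ideal (or_intror (erefl H)).
  rewrite XE HrH; split=> //; apply: (@group_t_full _ 1) (@is_zero1 G).
  exists 1; first exact: inH.
  exists 1; last by rewrite mulg1.
  by split=> [|y _]; [rewrite (quotientE HH) | exact: inH].
- by split=> //; left; rewrite (quotientE HH).
Qed.

End GroupCase.

Theorem corollary4p4 (M : cancelComMonoidType) :
  let H := in_quotient M in
  let t := t_system H in
  let w := w_system H in
  [<-> t_almost_Dedekind H /\ SP_monoid H t;
       SP_monoid H w;
       finite_conductor_monoid H w /\
         (forall X, principal H X -> radical_r_product H w X);
       forall X, r_ideal H w X -> comparable_radical_r_product H w X;
       forall X, principal H X -> nontrivial H X ->
         r_invertible H w (radical H X)].
Proof.
have [HG|HG] := pselect (in_quotient M = setT).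
  exact: equivalences_group.
exact: equivalences_nongroup.
Qed.
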